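(* Let $M$ be a real $n$-dimensional $C^\infty$-manifold, let $S$ be a semispray on $TM$ with local coefficients $G^i(x,y)$, and let $g=(g_{ij}(x,y))$ be a generalized Lagrange metric on $TM$, with inverse matrix $(g^{ij})$. Then there is a nonlinear connection $N^c$ on $TM$ which is metric with respect to $g$ (for the semispray $S$), whose local coefficients $N^{ci}_j$ in every induced local chart are $$N^{ci}_j=\frac12 g^{ik}S(g_{kj})+O^{ik}_{sj}\frac{\partial G^s}{\partial y^k},\qquad O^{ij}_{kl}=\frac12\left(\delta^i_k\delta^j_l-g^{ij}g_{kl}\right).$$
   Context: All objects are $C^\infty$ and the summation convention is used. $(x^i,y^i)$ are the local coordinates on $TM$ induced by local coordinates $(x^i)$ on $M$. The vertical distribution is $V_uTM=\ker(\pi_{*,u})$, $\pi:TM\to M$, spanned by $\partial/\partial y^i$. A d-tensor field is a tensor field on $TM$ described by component functions $(x,y)\mapsto T^{i\ldots}_{j\ldots}(x,y)$ which, under the changes of induced coordinates on $TM$, transform like the components of a tensor field on $M$. A semispray is a vector field $S$ on $TM$ with $JS=\mathbb{C}$, where $J=\frac{\partial}{\partial y^i}\otimes dx^i$ and $\mathbb{C}=y^i\frac{\partial}{\partial y^i}$; locally $S=y^i\frac{\partial}{\partial x^i}-2G^i(x,y)\frac{\partial}{\partial y^i}$, and the $G^i$ are its local coefficients. A nonlinear connection $N$ is an $n$-dimensional distribution $u\mapsto N_uTM$ on $TM$ with $T_uTM=N_uTM\oplus V_uTM$ for all $u$. Its local coefficients $N^i_j(x,y)$ are defined by $\frac{\delta}{\delta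 x^i}:=h\left(\frac{\partial}{\partial x^i}\right)=\frac{\partial}{\partial x^i}-N^j_i\frac{\partial}{\partial y^j}$, where $h$ is the projector onto $N$ along the vertical distribution. A generalized Lagrange metric is a symmetric d-tensor field with components $g_{ij}(x,y)$ such that the matrix $(g_{ij})$ has rank $n$ everywhere on $TM$. For vertical vector fields put $g(X^i\frac{\partial}{\partial y^i},Y^j\frac{\partial}{\partial y^j})=g_{ij}X^iY^j$. The dynamical covariant derivative of the pair $(S,N)$ is the operator on vertical vector fields $\nabla\left(X^i\frac{\partial}{\partial y^i}\right)=\left(S(X^i)+X^jN^i_j\right)\frac{\partial}{\partial y^i}$, extended to $g$ by $(\nabla g)(X,Y)=S(g(X,Y))-g(\nabla X,Y)-g(X,\nabla Y)$ for vertical $X,Y$; locally $(\nabla g)_{ij}=S(g_{ij})-g_{im}N^m_j-g_{mj}N^m_i$. The nonlinear connection $N$ is called metric with respect to $g$ (for $S$) if $\nabla g=0$. *)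

(* Defs.v *)
From HB Require Import structures.
From mathcomp Require Import all_boot all_order all_algebra.
From mathcomp Require Import all_classical all_reals all_analysis.

Set Implicit Arguments.
Unset Strict Implicit.
Unset Printing Implicit Defensive.

Import Order.TTheory GRing.Theory Num.Theory.
Import numFieldNormedType.Exports.

Local Open Scope classical_set_scope.
Local Open Scope ring_scope.

Fixpoint diff_on (R : realType) (V W : normedModType R) (k : nat)
    (U : set V) (f : V -> W) : Prop :=
  if k is k'.+1 then
    (forall x, U x -> differentiable f x) /\ forall v, diff_on k' U ('D_v f)
  else True.

(* C^oo, i.e. infinitely differentiable, on [U], which is meant to be open. *)
Definition smooth_on (R : realType) (V W : normedModType R)
    (U : set V) (f : V -> W) : Prop := forall k, diff_on k U f.

Section SmoothTheory.
Context {R : realType}.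
Implicit Types V W : normedModType R.

Lemma near0_differentiable V W (e : V -> W) x :
  (\forall y \near x, e y = 0) -> differentiable e x.
Proof.
move=> e0.
have ex0 : e x = 0 := nbhs_singleton e0.
have H : e \o shift x = cst (e x) + (\0 : V -> W) +o_ 0 id.
  rewrite ex0; apply/eqaddoP => _/posnumP[eps].
  have : \forall y \near (0 : V), e (y + x) = 0.
    by move: e0; rewrite (near_shift 0)/=; apply: filterS => y /=; rewrite subr0.
  apply: filterS => y ey.
  by rewrite !fctE /= ey addr0 subrr normr0 mulr_ge0.
have c0 : continuous (\0 : V -> W) by move=> y; exact: cst_continuous.
have d0 := @diff_unique _ V W e \0 x c0 H.
by apply/diff_locallyP; rewrite d0.
Qed.

Lemma near_eq_differentiable V W (f g : V -> W) x :
  {near x, f =1 g} -> differentiable f x -> differentiable g x.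
Proof.
move=> fg df; have -> : g = f + (g - f) by rewrite addrC subrK.
apply: differentiableD => //; apply: near0_differentiable.
by apply: filterS fg => y /= fy; rewrite !fctE /= fy subrr.
Qed.

Lemma open_near V (U : set V) (P : V -> Prop) x : open U -> U x ->
  (forall y, U y -> P y) -> \forall y \near x, P y.
Proof. by move=> oU Ux UP; apply: filterS UP _; exact: open_nbhs_nbhs. Qed.

Lemma eq_diff_on V W k (U : set V) (f g : V -> W) : open U ->
  (forall x, U x -> f x = g x) -> diff_on k U f -> diff_on k U g.
Proof.
move=> oU; elim: k f g => //= k IH f g fg [df Df].
split=> [x Ux|v].
  by apply: near_eq_differentiable (df x Ux); exact: (open_near oU Ux).
by apply: IH (Df v) => x Ux; apply: near_eq_derive; exact: (open_near oU Ux).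
Qed.

Lemma eq_smooth_on V W (U : set V) (f g : V -> W) : open U ->
  (forall x, U x -> f x = g x) -> smooth_on U f -> smooth_on U g.
Proof. by move=> oU fg sf k; apply: (eq_diff_on oU fg). Qed.

Lemma diff_on_sub V W k (U U' : set V) (f : V -> W) : U' `<=` U ->
  diff_on k U f -> diff_on k U' f.
Proof.
move=> sU; elim: k f => //= k IH f [df Df]; split=> [x /sU|v]; first exact: df.
exact: IH.
Qed.

Lemma diff_on_le V W k (U : set V) (f : V -> W) :
  diff_on k.+1 U f -> diff_on k U f.
Proof.
elim: k f => //= k IH f [df Df]; split=> // v; apply: IH; exact: Df.
Qed.

Lemma smooth_on_sub V W (U U' : set V) (f : V -> W) : U' `<=` U ->
  smooth_on U f -> smooth_on U' f.
Proof. by move=> sU sf k; apply: diff_on_sub (sf k). Qed.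

Lemma smooth_on_diff V W (U : set V) (f : V -> W) x :
  smooth_on U f -> U x -> differentiable f x.
Proof. by move=> /(_ 1%N)[df _]; exact: df. Qed.

Lemma smooth_on_derive V W (U : set V) (f : V -> W) v :
  smooth_on U f -> smooth_on U ('D_v f).
Proof. by move=> sf k; have [_ ] := sf k.+1; apply. Qed.

Lemma diff_on_cst V W k (U : set V) (a : W) : diff_on k U (fun _ : V => a).
Proof.
elim: k a => //= k IH a; split=> [x _|v]; first exact: differentiable_cst.
rewrite (_ : 'D_v _ = fun _ => 0); first exact: IH.
by apply/funext => x; rewrite derive_cst.
Qed.

Lemma diff_on_linear V W k (U : set V) (f : {linear V -> W}) : open U ->
  continuous f -> diff_on k U f.
Proof.
move=> oU cf; case: k => //= k; split=> [x _|v]; first exact: linear_differentiable.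
rewrite (_ : 'D_v _ = fun _ => f v); first exact: diff_on_cst.
by apply/funext => x; rewrite deriveE ?diff_lin//; exact: linear_differentiable.
Qed.

Lemma diff_onD V W k (U : set V) (f g : V -> W) : open U ->
  diff_on k U f -> diff_on k U g -> diff_on k U (f \+ g).
Proof.
move=> oU; elim: k f g => //= k IH f g [df Df] [dg Dg]; split=> [x Ux|v].
  by apply: differentiableD; [exact: df|exact: dg].
apply: (eq_diff_on (f := 'D_v f \+ 'D_v g)) => // [x Ux|]; last exact: IH.
by rewrite deriveD//; apply: diff_derivable; [exact: df|exact: dg].
Qed.

Lemma diff_on_sum V W k (U : set V) (I : Type) (r : seq I) (f : I -> V -> W) :
  open U -> (forall i, diff_on k U (f i)) ->
  diff_on k U (fun x => \sum_(i <- r) f i x).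
Proof.
move=> oU df; elim: r => [|i r IH].
  by under eq_fun do rewrite big_nil; exact: diff_on_cst.
under eq_fun do rewrite big_cons.
exact: (@diff_onD _ _ k U (f i)).
Qed.

Lemma diff_onM V k (U : set V) (f g : V -> R) : open U ->
  diff_on k U f -> diff_on k U g -> diff_on k U (f \* g).
Proof.
move=> oU; elim: k f g => // k IH f g df dg.
have [df0 Df] := df; have [dg0 Dg] := dg.
have dfk := diff_on_le df; have dgk := diff_on_le dg.
split=> [x Ux|v].
  by apply: differentiableM; [exact: df0|exact: dg0].
apply: (eq_diff_on (f := (f \* 'D_v g) \+ (g \* 'D_v f))) => // [x Ux|].
  have dfx : derivable f x v by apply: diff_derivable; exact: df0.
  have dgx : derivable g x v by apply: diff_derivable; exact: dg0.
  by rewrite -[f \* g]/(f * g) deriveM.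
by apply: diff_onD => //; apply: IH => //; [exact: Dg|exact: Df].
Qed.

Lemma diff_on_mx V k (U : set V) m p (f : V -> 'M[R]_(m, p)) : open U ->
  diff_on k U f <-> forall i j, diff_on k U (fun x => f x i j).
Proof.
move=> oU; split.
  elim: k f => //= k IH f [df Df] i j; split=> [x Ux|v].
    apply: (differentiable_comp (g := fun N : 'M[R]_(m, p) => N i j)).
      exact: df.
    exact: differentiable_coord.
  apply: (eq_diff_on (f := fun x => 'D_v f x i j)) => // [x Ux|]; last first.
    exact: IH.
  by rewrite derive_mx ?mxE//; apply: diff_derivable; exact: df.
elim: k f => //= k IH f df; split=> [x Ux|v].
  rewrite (_ : f = \sum_i \sum_j (fun x => f x i j *: delta_mx i j)).
    apply: differentiable_sum => i; apply: differentiable_sum => j.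
    by apply: differentiableZl; have [+ _] := df i j; apply.
  apply/funext => y; rewrite {1}[f y]matrix_sum_delta fct_sumE.
  by apply: eq_bigr => i _; rewrite fct_sumE.
apply: IH => i j; have [_ /(_ v)] := df i j.
apply: eq_diff_on => // x Ux; rewrite derive_mx ?mxE//.
by apply/derivable_mxP => a b; apply: diff_derivable; have [+ _] := df a b; apply.
Qed.

Lemma smooth_on_mx V (U : set V) m p (f : V -> 'M[R]_(m, p)) : open U ->
  smooth_on U f <-> forall i j, smooth_on U (fun x => f x i j).
Proof.
move=> oU; split=> [sf i j k|sf k]; last by apply/diff_on_mx => // i j; exact: sf.
by have /(diff_on_mx k f oU) := sf k; exact.
Qed.

Lemma diff_on_comp_linear V V' W k (U : set V) (L : {linear V' -> V})
    (f : V -> W) : open U -> continuous L ->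
  diff_on k U f -> diff_on k (L @^-1` U) (f \o L).
Proof.
move=> oU cL; have dL x : differentiable L x by exact: linear_differentiable.
have oLU : open (L @^-1` U) by apply: open_comp => // x _; exact: cL.
elim: k f => //= k IH f [df Df]; split=> [x /= /df dfx|v].
  exact: differentiable_comp.
apply: (eq_diff_on (f := 'D_(L v) f \o L)) => // [x /= /df dfx|]; last first.
  by apply: IH; exact: Df.
rewrite /= deriveE// (deriveE _ (differentiable_comp (dL x) dfx)).
by rewrite [in RHS]diff_comp//= diff_lin.
Qed.

Lemma smooth_on_comp_linear V V' W (U : set V) (L : {linear V' -> V})
    (f : V -> W) : open U -> continuous L ->
  smooth_on U f -> smooth_on (L @^-1` U) (f \o L).
Proof. by move=> oU cL sf k; exact: diff_on_comp_linear. Qed.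

Lemma diff_near_comp V V' W (f : V -> V') (g : V' -> W) (h : V -> W) x x' y :
  f x = x' -> differentiable f x -> differentiable g x' -> differentiable h x ->
  {near x, g \o f =1 h} -> 'd h x y = 'd g x' ('d f x y).
Proof.
move=> <- df dg dh gf; rewrite -(deriveE y dh) -(near_eq_derive y gf).
rewrite deriveE; last exact: differentiable_comp.
by rewrite diff_comp.
Qed.

Lemma diff_near_id V (f : V -> V) x y :
  differentiable f x -> {near x, f =1 id} -> 'd f x y = y.
Proof.
by move=> df fi; rewrite -(deriveE y df) (near_eq_derive y fi) derive_id.
Qed.

End SmoothTheory.

(* A smooth n-dimensional atlas on [X]: charts are bijections from [adom i] onto
   open subsets of R^n, with smooth transition maps on open overlaps. [ainv i]
   is the inverse chart; its values outside the image of the chart are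
   irrelevant. An atlas need not be maximal: the charts of a smooth structure
   are obtained by taking the maximal atlas. *)
Record atlas (R : realType) (n : nat) (X : Type) := Atlas {
  aidx : Type;
  adom : aidx -> set X;
  acoord : aidx -> X -> 'rV[R]_n;
  ainv : aidx -> 'rV[R]_n -> X;
  atlas_cover : forall p, exists i, adom i p;
  atlas_coordK : forall i p, adom i p -> ainv i (acoord i p) = p;
  atlas_open : forall i j, open (acoord i @` (adom i `&` adom j));
  atlas_smooth : forall i j,
    smooth_on (acoord i @` (adom i `&` adom j)) (acoord j \o ainv i)
}.

Section Atlas.
Context {R : realType} {n : nat} {X : Type} (A : atlas R n X).

Definition aimg (i : aidx A) : set 'rV[R]_n := acoord i @` adom i.

Definition atrans (i j : aidx A) : 'rV[R]_n -> 'rV[R]_n := acoord j \o ainv i.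

(* Openness in the topology induced by the atlas. *)
Definition aopen (W : set X) : Prop :=
  forall i : aidx A, open (acoord i @` (adom i `&` W)).

(* A tangent vector at [p] is the family of its components in the charts around
   [p], extended by zero to the other charts; the linear structure is that of
   the ambient function space. *)
Definition tangent_space (p : X) : set (aidx A -> 'rV[R]_n) :=
  [set v | (forall i j, adom i p -> adom j p ->
              v j = 'd (atrans i j) (acoord i p) (v i))
         /\ (forall i, ~ adom i p -> v i = 0)].

(* The tangent vector at [p] with components [y] in the chart [i]
   (zero when [p] is not in that chart). *)
Definition tvector (i : aidx A) (p : X) (y : 'rV[R]_n) : aidx A -> 'rV[R]_n :=
  fun j => if `[< adom i p /\ adom j p >]
           then 'd (atrans i j) (acoord i p) y else 0.

Lemma atrans_coord i j p : adom i p -> atrans i j (acoord i p) = acoord j p.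
Proof. by move=> ip; rewrite /atrans /= atlas_coordK. Qed.

Lemma atrans_diff i j p : adom i p -> adom j p ->
  differentiable (atrans i j) (acoord i p).
Proof. by move=> ip jp; apply: smooth_on_diff (atlas_smooth i j) _; exists p. Qed.

Lemma atrans_cocycle i j k p : adom i p -> adom j p -> adom k p ->
  {near acoord i p, atrans j k \o atrans i j =1 atrans i k}.
Proof.
move=> ip jp kp.
have n1 : \forall z \near acoord i p, (acoord i @` (adom i `&` adom j)) z.
  by apply: open_nbhs_nbhs; split; [exact: atlas_open|exists p].
have : \forall z \near acoord i p,
    (acoord j @` (adom j `&` adom k)) (atrans i j z).
  apply: (differentiable_continuous (atrans_diff ip jp)).
  rewrite atrans_coord//.
  by apply: open_nbhs_nbhs; split; [exact: atlas_open|exists p].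
apply: filterS2 n1 => _ [q [iq jq] <-] [q' [jq' kq']].
rewrite atrans_coord// /= => qq'.
have e : q = q' by rewrite -(atlas_coordK jq) -qq' atlas_coordK.
by rewrite !atrans_coord// e.
Qed.

Lemma atrans_chain i j k p y : adom i p -> adom j p -> adom k p ->
  'd (atrans i k) (acoord i p) y =
  'd (atrans j k) (acoord j p) ('d (atrans i j) (acoord i p) y).
Proof.
move=> ip jp kp; apply: (diff_near_comp (f := atrans i j)).
- exact: atrans_coord.
- exact: atrans_diff.
- exact: atrans_diff.
- exact: atrans_diff.
- exact: atrans_cocycle.
Qed.

Lemma atrans_id i p y : adom i p -> 'd (atrans i i) (acoord i p) y = y.
Proof.
move=> ip; apply: diff_near_id; first exact: atrans_diff.
have : nbhs (acoord i p) (acoord i @` (adom i `&` adom i)).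
  by apply: open_nbhs_nbhs; split; [exact: atlas_open|exists p].
by apply: filterS => _ [q [iq _] <-]; rewrite atrans_coord.
Qed.

Lemma tvectorP i p y : tangent_space p (tvector i p y).
Proof.
split=> [j k jp kp|j njp]; rewrite /tvector.
  case: (pselect (adom i p)) => ip; last first.
    by rewrite !asboolF ?linear0// => -[].
  by rewrite !asboolT//; exact: atrans_chain.
by rewrite asboolF// => -[].
Qed.

Lemma tvectorE i p y j : adom i p -> adom j p ->
  tvector i p y j = 'd (atrans i j) (acoord i p) y.
Proof. by move=> ip jp; rewrite /tvector asboolT. Qed.

Record tbundle := TBundle {
  tbase : X;
  tvec : aidx A -> 'rV[R]_n;
  tvecP : tangent_space tbase tvec
}.

Lemma tbundle_eq (u v : tbundle) : tbase u = tbase v -> tvec u = tvec v -> u = v.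
Proof.
case: u v => [p v vP] [q w wP] /= pq vw; case: q / pq wP => wP.
by case: w / vw wP => wP; congr TBundle; exact: Prop_irrelevance.
Qed.

(* The charts of the tangent bundle induced by those of the base, with
   coordinates (x, y). *)
Definition tdom (i : aidx A) : set tbundle := [set u | adom i (tbase u)].

Definition tcoord (i : aidx A) (u : tbundle) : 'rV[R]_(n + n) :=
  row_mx (acoord i (tbase u)) (tvec u i).

Definition tinv (i : aidx A) (z : 'rV[R]_(n + n)) : tbundle :=
  TBundle (tvectorP i (ainv i (lsubmx z)) (rsubmx z)).

Lemma tdom_cover u : exists i, tdom i u.
Proof. exact: atlas_cover. Qed.

Lemma tcoordK i u : tdom i u -> tinv i (tcoord i u) = u.
Proof.
move=> iu; apply: tbundle_eq => /=; rewrite row_mxKl atlas_coordK//.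
apply/funext => j; rewrite row_mxKr.
have [uE u0] := tvecP u; case: (pselect (adom j (tbase u))) => ju.
  by rewrite tvectorE// -uE.
by rewrite (u0 _ ju) /tvector asboolF// => -[].
Qed.

Lemma tcoord_img i j : tcoord i @` (tdom i `&` tdom j) =
  lsubmx @^-1` (acoord i @` (adom i `&` adom j)).
Proof.
apply/seteqP; split=> [_ [u [iu ju] <-]|z [p [ip jp] pz]] /=.
  by exists (tbase u) => //; rewrite row_mxKl.
have bz : ainv i (lsubmx z) = p by rewrite -pz atlas_coordK.
exists (tinv i z); first by rewrite /tdom /= bz.
by rewrite /tcoord /= bz tvectorE// atrans_id// pz hsubmxK.
Qed.

Lemma tcoord_open i j : open (tcoord i @` (tdom i `&` tdom j)).
Proof.
rewrite tcoord_img; apply: open_comp => [z _|]; last exact: atlas_open.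
exact: continuous_lsubmx.
Qed.

Lemma tcoord_smooth i j :
  smooth_on (tcoord i @` (tdom i `&` tdom j)) (tcoord j \o tinv i).
Proof.
have oU := @tcoord_open i j; rewrite tcoord_img in oU *.
set U := acoord i @` (adom i `&` adom j) in oU *.
have sm (f : 'rV[R]_n -> 'rV[R]_n) : smooth_on U f ->
    smooth_on (lsubmx @^-1` U) (f \o (lsubmx : 'rV[R]_(n + n) -> 'rV[R]_n)).
  by apply: smooth_on_comp_linear; [exact: atlas_open|exact: continuous_lsubmx].
pose F (z : 'rV[R]_(n + n)) : 'rV[R]_(n + n) :=
  row_mx (atrans i j (lsubmx z)) (\row_l \sum_(k < n)
    (rsubmx z 0 k * ('D_(delta_mx 0 k) (atrans i j) (lsubmx z)) 0 l)).
apply: (eq_smooth_on (f := F)) => // [z [p [ip jp] pz]|].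
  have bz : ainv i (lsubmx z) = p by rewrite -pz atlas_coordK.
  rewrite /F /tcoord /= bz -pz atrans_coord//; congr row_mx.
  rewrite tvectorE//; apply/rowP => l; rewrite mxE.
  rewrite {2}[rsubmx z]row_sum_delta linear_sum summxE; apply: eq_bigr => k _.
  rewrite deriveE; first by rewrite linearZ /= !mxE.
  exact: atrans_diff.
apply/smooth_on_mx => // r c; rewrite ord1.
case: (split_ordP c) => l ->.
  under eq_fun do rewrite /F row_mxEl.
  by have /smooth_on_mx-/(_ oU) := sm _ (atlas_smooth i j); apply.
under eq_fun do rewrite /F row_mxEr mxE.
move=> m; apply: diff_on_sum => // k; apply: diff_onM => //.
  apply: (diff_on_mx m (fun z : 'rV[R]_(n + n) => rsubmx z) oU).1.
  by apply: diff_on_linear => //; exact: continuous_rsubmx.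
have := sm _ (smooth_on_derive (delta_mx 0 k) (atlas_smooth i j)).
by move=> /(smooth_on_mx _ oU)/(_ 0 l)/(_ m).
Qed.

Definition tatlas : atlas R (n + n) tbundle :=
  Atlas tdom_cover tcoordK tcoord_open tcoord_smooth.

End Atlas.

Arguments aimg {R n X} A i.
Arguments atrans {R n X} A i j.
Arguments tangent_space {R n X} A p.
Arguments tvector {R n X} A i p y.
Arguments tbase {R n X A} t.

Section VectorFields.
Context {R : realType} {m : nat} {X : Type} (A : atlas R m X).

Definition smooth_field (W : set X) (F : X -> aidx A -> 'rV[R]_m) : Prop :=
  (forall p, W p -> tangent_space A p (F p)) /\
  forall i : aidx A,
    smooth_on (acoord i @` (adom i `&` W)) (fun z => F (ainv i z) i).

(* A smooth distribution of rank [k]: locally, the span of [k] pointwise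
   linearly independent smooth vector fields. *)
Definition smooth_distribution (k : nat)
    (D : X -> set (aidx A -> 'rV[R]_m)) : Prop :=
  forall p, exists (W : set X) (E : 'I_k -> X -> aidx A -> 'rV[R]_m),
    [/\ aopen A W, W p, (forall r, smooth_field W (E r)) &
     forall q, W q ->
       D q = [set v | exists c : 'I_k -> R, v = \sum_r c r *: E r q] /\
       (forall c : 'I_k -> R,
          \sum_r c r *: E r q = 0 -> forall r, c r = 0)].

End VectorFields.

Arguments smooth_field {R m X} A W F.
Arguments smooth_distribution {R m X} A k D.

(* The topology of [M] is the one induced by the atlas. *)
Definition smooth_manifold (R : realType) (n : nat) (M : topologicalType)
    (A : atlas R n M) : Prop :=
  [/\ forall W : set M, open W <-> aopen A W,
      hausdorff_space M & @second_countable M].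

(* In the chart of TM induced by [a], points, and the components of tangent
   vectors to TM, are row vectors of size n + n: the left half is the x part,
   the right half the y part. *)
Section TangentGeometry.
Context {R : realType} {n : nat} {M : Type} (A : atlas R n M).
Local Notation TM := (tbundle A).
Local Notation TA := (tatlas A).
Local Notation field := (TM -> aidx TA -> 'rV[R]_(n + n)).
Local Notation tinv := (@tinv R n M A).
Local Notation tcoord := (@tcoord R n M A).
Local Notation tdom := (@tdom R n M A).

(* The kernel of the differential of the projection [tbase] at [u], computed in
   the charts [a] of M and TM. *)
Definition vertical (u : TM) : set (aidx TA -> 'rV[R]_(n + n)) :=
  [set w | tangent_space TA u w /\
     forall a, tdom a u ->
       'd (acoord a \o tbase \o tinv a) (tcoord a u) (w a) = 0].

Definition vertical_field (W : set TM) (F : field) : Prop :=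
  smooth_field TA W F /\ forall u, W u -> vertical u (F u).

(* J (a^i d/dx^i + b^i d/dy^i) = a^i d/dy^i *)
Definition tangent_structure (w : 'rV[R]_(n + n)) : 'rV[R]_(n + n) :=
  row_mx 0 (lsubmx w).

(* C (x, y) = y^i d/dy^i *)
Definition liouville (z : 'rV[R]_(n + n)) : 'rV[R]_(n + n) :=
  row_mx 0 (rsubmx z).

Definition semispray (S : field) : Prop :=
  smooth_field TA setT S /\
  forall a u, tdom a u -> tangent_structure (S u a) = liouville (tcoord a u).

(* G^i, where S = y^i d/dx^i - 2 G^i d/dy^i in the chart [a]. *)
Definition spray_coef (S : field) (a : aidx A) (z : 'rV[R]_(n + n)) : 'rV[R]_n :=
  - 2^-1 *: rsubmx (S (tinv a z) a).

Definition nonlinear_connection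
    (N : TM -> set (aidx TA -> 'rV[R]_(n + n))) : Prop :=
  [/\ smooth_distribution TA n N,
      forall u, N u `&` vertical u = [set 0] &
      forall u w, tangent_space TA u w ->
        exists v1 v2, [/\ N u v1, vertical u v2 & w = v1 + v2]].

(* The projector onto [N] along the vertical distribution. *)
Definition hproj (N : TM -> set (aidx TA -> 'rV[R]_(n + n))) (u : TM)
    (w : aidx TA -> 'rV[R]_(n + n)) : aidx TA -> 'rV[R]_(n + n) :=
  xget 0 [set v | N u v /\ vertical u (w - v)].

Definition coord_field_x (a : aidx A) (j : 'I_n) : field :=
  fun u => tvector TA a u (row_mx (delta_mx 0 j) 0).

(* The entry (i, j) is N^i_j, where
   h (d/dx^j) = d/dx^j - N^i_j d/dy^i in the chart [a]. *)
Definition conn_coef (N : TM -> set (aidx TA -> 'rV[R]_(n + n)))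
    (a : aidx A) (z : 'rV[R]_(n + n)) : 'M[R]_n :=
  \matrix_(i, j)
     - rsubmx (hproj N (tinv a z) (coord_field_x a j (tinv a z)) a) 0 i.

(* The derivative S(f), for f given by its expression [F] in the chart [a]. *)
Definition field_deriv (S : field) (a : aidx A) (F : 'rV[R]_(n + n) -> R)
    (z : 'rV[R]_(n + n)) : R :=
  'D_(S (tinv a z) a) F z.

Definition dy (k : 'I_n) (F : 'rV[R]_(n + n) -> R) (z : 'rV[R]_(n + n)) : R :=
  'D_(row_mx 0 (delta_mx 0 k)) F z.

(* [g a z i j] is g_ij (x, y) in the chart [a]; the Jacobian of [atrans a b]
   has the entry d x~^k / d x^i in row i and column k. *)
Definition dtensor02 (g : aidx A -> 'rV[R]_(n + n) -> 'M[R]_n) : Prop :=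
  (forall a i j, smooth_on (aimg TA a) (fun z => g a z i j)) /\
  forall a b u, tdom a u -> tdom b u ->
    let P := jacobian (atrans A a b) (acoord a (tbase u)) in
    g a (tcoord a u) = P *m g b (tcoord b u) *m P^T.

Definition gen_lagrange_metric
    (g : aidx A -> 'rV[R]_(n + n) -> 'M[R]_n) : Prop :=
  dtensor02 g /\
  forall a z, aimg TA a z -> (g a z)^T = g a z /\ \rank (g a z) = n.

Definition vcomp (F : field) (a : aidx A) (z : 'rV[R]_(n + n)) : 'rV[R]_n :=
  rsubmx (F (tinv a z) a).

(* The expression of g(F1, F2) in the chart [a]. *)
Definition metric_form (g : aidx A -> 'rV[R]_(n + n) -> 'M[R]_n)
    (F1 F2 : field) (a : aidx A) (z : 'rV[R]_(n + n)) : R :=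
  \sum_i \sum_j g a z i j * vcomp F1 a z 0 i * vcomp F2 a z 0 j.

Definition dyn_deriv (S : field) (N : TM -> set (aidx TA -> 'rV[R]_(n + n)))
    (F : field) : field :=
  fun u a => if `[< tdom a u >] then
    row_mx 0 (\row_i
      (field_deriv S a (fun z => vcomp F a z 0 i) (tcoord a u) +
       \sum_j vcomp F a (tcoord a u) 0 j * conn_coef N a (tcoord a u) i j))
  else 0.

(* The expression of (nabla g)(F1, F2) in the chart [a]. *)
Definition dyn_deriv_metric (S : field)
    (N : TM -> set (aidx TA -> 'rV[R]_(n + n)))
    (g : aidx A -> 'rV[R]_(n + n) -> 'M[R]_n)
    (F1 F2 : field) (a : aidx A) (z : 'rV[R]_(n + n)) : R :=
  field_deriv S a (metric_form g F1 F2 a) z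
  - metric_form g (dyn_deriv S N F1) F2 a z
  - metric_form g F1 (dyn_deriv S N F2) a z.

(* Vertical fields on arbitrary open subsets, so that local ones, such as
   d/dy^i, are included. *)
Definition metric_connection (S : field)
    (N : TM -> set (aidx TA -> 'rV[R]_(n + n)))
    (g : aidx A -> 'rV[R]_(n + n) -> 'M[R]_n) : Prop :=
  forall (W : set TM) (F1 F2 : field), aopen TA W ->
    vertical_field W F1 -> vertical_field W F2 ->
    forall a u, tdom a u -> W u ->
      dyn_deriv_metric S N g F1 F2 a (tcoord a u) = 0.

(* O^{ij}_{kl}, for the value [g] of the metric at a point. *)
Definition obata (g : 'M[R]_n) (i j k l : 'I_n) : R :=
  2^-1 * ((i == k)%:R * (j == l)%:R - invmx g i j * g k l).

End TangentGeometry.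

(* Main.v *)
Require Import Defs.
From mathcomp Require Import all_boot all_order all_algebra.
From mathcomp Require Import all_classical all_reals all_analysis.
From mathcomp Require Import ring lra.

Import Order.TTheory GRing.Theory Num.Theory.
Import numFieldNormedType.Exports.

Local Open Scope classical_set_scope.
Local Open Scope ring_scope.

Set Implicit Arguments.
Unset Strict Implicit.
Unset Printing Implicit Defensive.

(** A nonlinear connection is the same thing as a family of smooth matrices, one
    for each induced chart, that obeys an affine transformation law. It is
    convenient to let matrices act on row vectors, so let [L] be the transpose
    of the matrix of the coefficients [N^i_j]; the horizontal vectors at
    [z = (x, y)] are then the [(xi, - xi L(z))]. Write [P] for the Jacobian of a
    chart change of the base, and [Q] for the derivative of [P] at [x] in the
    direction [y]. The induced chart change of the tangent bundle has
    differential [(xi, eta) |-> (xi P, eta P + xi Q)] ([diff_atrans_tatlas]), so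
    the distribution is independent of the chart as soon as
    [L_a P = P L_b + Q] ([horizontal_lift_coord]). Smoothness of [L] then gives a smooth
    local frame of horizontal lifts ([horizontal_connection]).

    In this notation the required coefficients are
    [L = (S(g) g^-1 + E - g E^T g^-1) / 2], where [E] is the matrix of the
    vertical derivatives of the [G^i]. The law for [L] follows by matrix algebra
    ([canonical_mx_trans]) from two laws. The first one,
    [E_a P = P E_b + Q] ([spray_mx_trans]), comes from differentiating the
    transformation of a semispray, [G_b = G_a P - y Q / 2], in a vertical
    direction. The second one,
    [S(g_a) = Q g_b P^T + P S(g_b) P^T + P g_b Q^T] ([metric_deriv_trans]), comes
    from differentiating [g_a = P g_b P^T] along the semispray. Both rest on the
    symmetry of the second derivatives of the chart changes, which is proved for
    functions whose first derivatives are differentiable ([derive_comm_real]).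

    Finally [S(g) = L g + g L^T] is an identity between matrices
    ([canonical_mx_metric]), and by the Leibniz rule it says that the dynamical
    covariant derivative of [g] vanishes ([metric_connectionP]). *)

(** * Symmetry of second derivatives *)

Section MixedDerivatives.
Context {R : realType} {V : normedModType R}.
Implicit Types (f : V -> R) (x u v : V).

(** A directional derivative is an ordinary derivative along the line that it
    follows, which is what the one-variable mean value theorem applies to. *)
Lemma is_derive_line f u c (s : R) : derivable f (s *: u + c) u ->
  is_derive s 1 (fun r => f (r *: u + c)) ('D_u f (s *: u + c)).
Proof.
have e : (fun h : R => h^-1 *: (((fun r : R => f (r *: u + c)) \o shift s) (h *: 1)
      - f (s *: u + c))) =
    (fun h : R => h^-1 *: ((f \o shift (s *: u + c)) (h *: u) - f (s *: u + c))).
  by apply/funext => h /=; rewrite [h%:A]mulr1 scalerDl addrA.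
move=> df; apply: DeriveDef; first by rewrite /derivable e.
by rewrite /derive e.
Qed.

(** The second difference of [f] with steps [t u] and [t v] is symmetric in
    [u] and [v]; this estimate identifies its leading term with
    [t ^ 2 D_v D_u f (x)]. The mean value theorem in the direction [u] turns the
    second difference into [t] times an increment of [D_u f], and differentiability
    of [D_u f] at [x] alone controls that increment. *)
Lemma second_difference f x u v (e : R) :
  (\forall y \near x, differentiable f y) -> differentiable ('D_u f) x ->
  0 < e -> \forall t \near 0^'+,
    `|f (t *: u + t *: v + x) - f (t *: u + x) - f (t *: v + x) + f x
      - t ^+ 2 * 'D_v ('D_u f) x| <= e * t ^+ 2.
Proof.
move=> df dDf e0; set h := 'D_u f in dDf *.
(* The points visited below are within t C of x. *)
pose C := `|u| + `|v| + 1.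
have C0 : 0 < C by rewrite /C; have := normr_ge0 u; have := normr_ge0 v; lra.
have [d d0 dP] : exists2 d : R, 0 < d & forall w, `|w| < d ->
    differentiable f (w + x) /\
    `|h (w + x) - h x - 'd h x w| <= (e / (2 * C)) * `|w|.
  have n1 : \forall w \near (0 : V), differentiable f (w + x).
    move: df; rewrite (near_shift 0) /=.
    by apply: filterS => y /=; rewrite subr0.
  have n2 : \forall w \near (0 : V),
      `|h (w + x) - h x - 'd h x w| <= (e / (2 * C)) * `|w|.
    have /diff_locally/eqaddoP/(_ (e / (2 * C))) := dDf.
    have e20 : 0 < e / (2 * C) by apply: divr_gt0 => //; apply: mulr_gt0.
    move=> /(_ e20); apply: filterS => w.
    by rewrite !fctE /= opprD addrA.
  have /nbhs_ballP[d /= d0 dP] : \forall w \near (0 : V), differentiable f (w + x) /\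
    `|h (w + x) - h x - 'd h x w| <= (e / (2 * C)) * `|w| by exact: filterI.
  exists d => // w wd; apply: dP.
  by rewrite -ball_normE /= sub0r normrN.
near=> t.
have t0 : 0 < t by near: t; exact: nbhs_right_gt.
have tC : t * C < d.
  rewrite -ltr_pdivlMr//; near: t; apply: nbhs_right_lt.
  exact: divr_gt0.
have small s : s \in `[0, t] -> `|s *: u| <= t * C /\ `|s *: u + t *: v| <= t * C.
  rewrite in_itv /= => /andP[s0 st].
  have su : `|s *: u| <= t * `|u| by rewrite normrZ ger0_norm// ler_wpM2r.
  have tv : `|t *: v| = t * `|v| by rewrite normrZ gtr0_norm.
  have := ler_normD (s *: u) (t *: v).
  rewrite /C tv; have : 0 <= t * `|v| by rewrite mulr_ge0// ltW.
  by split; nra.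
(* The second difference is psi t - psi 0. *)
pose psi s := f (s *: u + (t *: v + x)) - f (s *: u + x).
pose dpsi s := h (s *: u + (t *: v + x)) - h (s *: u + x).
have dpsiP s : s \in `[0, t] -> is_derive s 1 psi (dpsi s).
  move=> /small[l1 l2]; apply: is_deriveB; apply: is_derive_line.
    rewrite addrA; apply: diff_derivable; apply: (dP _ _).1.
    exact: le_lt_trans tC.
  by apply: diff_derivable; apply: (dP _ _).1; exact: le_lt_trans tC.
have cpsi : {within `[0, t], continuous psi}.
  by apply: derivable_within_continuous => s /dpsiP[].
have dpsi0 s : s \in `]0, t[ -> is_derive s 1 psi (dpsi s).
  by move=> sI; apply: dpsiP; exact: subset_itv_oo_cc sI.
have [s sI E] := MVT t0 dpsi0 cpsi.
have {sI} /small[l1 l2] : s \in `[0, t] by exact: subset_itv_oo_cc sI.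
have [_ b1] := dP _ (le_lt_trans l1 tC); have [_ b2] := dP _ (le_lt_trans l2 tC).
have -> : f (t *: u + t *: v + x) - f (t *: u + x) - f (t *: v + x) + f x =
    psi t - psi 0.
  by rewrite /psi !scale0r !add0r addrA; ring.
rewrite E /dpsi subr0 deriveE// -/h addrA.
move: b2; rewrite linearD/= [X in _ - (_ + X)]linearZ /= => b2.
have k0 : 0 < e / (2 * C) by apply: divr_gt0 => //; apply: mulr_gt0.
have {}b1 := le_trans b1 (ler_wpM2l (ltW k0) l1).
have {}b2 := le_trans b2 (ler_wpM2l (ltW k0) l2).
have kk : e / (2 * C) * (t * C) = e * t / 2 by field; rewrite gt_eqF.
rewrite kk in b1 b2; move: b1 b2.
set A := h (_ + _ + _); set B := h (s *: u + x); set D := 'd h x v.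
set F := 'd h x (s *: u) => b1 b2.
have -> : (A - B) * t - t ^+ 2 * D = (A - B - t * D) * t by ring.
rewrite normrM (gtr0_norm t0) [t ^+ 2]expr2 mulrA ler_pM2r//.
move: b1 b2; rewrite !ler_norml => /andP[p1 p2] /andP[p3 p4]; apply/andP.
change (t *: D) with (t * D) in *.
by split; lra.
Unshelve. all: by end_near. Qed.

Fact close_quotients (a b c d p q T e : R) : 0 < T ->
  `|a - b - c + d - T * p| <= e / 2 * T ->
  `|a - c - b + d - T * q| <= e / 2 * T -> `|p - q| <= e.
Proof.
move=> T0 /ler_normlP[p1 p2] /ler_normlP[p3 p4].
by apply/ler_normlP; split; rewrite -(ler_pM2r T0); nra.
Qed.

(** Young's form of the symmetry theorem: no continuity of the second
    derivatives is involved, since both mixed derivatives are the limit of the same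
    second difference divided by [t ^ 2]. *)
Lemma derive_comm_real f x u v :
  (\forall y \near x, differentiable f y) ->
  differentiable ('D_u f) x -> differentiable ('D_v f) x ->
  'D_v ('D_u f) x = 'D_u ('D_v f) x.
Proof.
move=> df du dv; apply/eqP; rewrite -subr_eq0 -normr_le0; apply/ler_addgt0Pr => e e0.
rewrite add0r.
have e2 : 0 < e / 2 by exact: divr_gt0.
have pos : \forall t \near (0 : R)^'+, 0 < t by exact: nbhs_right_gt.
have n1 := second_difference v df du e2.
have n2 := second_difference u df dv e2.
have [t [[t0 +] +]] := filter_ex (filterI (filterI pos n1) n2).
rewrite [t *: v + t *: u]addrC => i1 i2.
by apply: close_quotients i1 i2; exact: exprn_gt0.
Qed.

End MixedDerivatives.

(** * Derivatives and smoothness of matrix-valued maps *)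

Section MatrixCalculus.
Context {R : realType} {V : normedModType R}.
Implicit Types (x u v : V) (U : set V).

Lemma is_derive_mulmx m p q (F : V -> 'M[R]_(m, p)) (G : V -> 'M[R]_(p, q)) x v :
  derivable F x v -> derivable G x v ->
  is_derive x v (fun y => F y *m G y) ('D_v F x *m G x + F x *m 'D_v G x).
Proof.
move=> dF dG; have dFe := (derivable_mxP _ _ _).1 dF.
have dGe := (derivable_mxP _ _ _).1 dG.
have e i j : (fun y => (F y *m G y) i j) =
    \sum_k ((fun y => F y i k) * (fun y => G y k j)).
  by apply/funext => y; rewrite fct_sumE mxE.
have de i j : derivable (fun y => (F y *m G y) i j) x v.
  by rewrite e; apply: derivable_sum => k; exact: derivableM.
have d : derivable (fun y => F y *m G y) x v by exact/derivable_mxP.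
apply: DeriveDef => //; rewrite derive_mx//; apply/matrixP => i j.
rewrite !mxE e derive_sum => [|k]; last exact: derivableM.
rewrite -big_split /=; apply: eq_bigr => k _.
by rewrite deriveM// !derive_mx// !mxE addrC [G x k j *: _]mulrC.
Qed.

Lemma derive_mulmx m p q (F : V -> 'M[R]_(m, p)) (G : V -> 'M[R]_(p, q)) x v :
  derivable F x v -> derivable G x v ->
  'D_v (fun y => F y *m G y) x = 'D_v F x *m G x + F x *m 'D_v G x.
Proof. by move=> dF dG; have [_ ->] := is_derive_mulmx dF dG. Qed.

Lemma derivable_trmx m p (F : V -> 'M[R]_(m, p)) x v :
  derivable F x v -> derivable (fun y => (F y)^T) x v.
Proof.
move=> /derivable_mxP dF; apply/derivable_mxP => i j.
by under eq_fun do rewrite mxE; exact: dF.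
Qed.

Lemma derive_trmx m p (F : V -> 'M[R]_(m, p)) x v :
  derivable F x v -> 'D_v (fun y => (F y)^T) x = ('D_v F x)^T.
Proof.
move=> dF; rewrite !derive_mx//; last exact: derivable_trmx.
by apply/matrixP => i j; rewrite !mxE; under eq_fun do rewrite mxE.
Qed.

Lemma derive_mxE m p (F : V -> 'M[R]_(m, p)) x v i j :
  derivable F x v -> 'D_v F x i j = 'D_v (fun y => F y i j) x.
Proof. by move=> dF; rewrite derive_mx// mxE. Qed.

Lemma derivable_smooth (W : normedModType R) (f : V -> W) U x v :
  smooth_on U f -> U x -> derivable f x v.
Proof. by move=> sf Ux; apply: diff_derivable; exact: smooth_on_diff Ux. Qed.

Lemma derive_comm m p (F : V -> 'M[R]_(m, p)) U x u v :
  open U -> smooth_on U F -> U x -> 'D_v ('D_u F) x = 'D_u ('D_v F) x.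
Proof.
move=> oU sF Ux; apply/matrixP => i j.
have e w w' : 'D_w ('D_w' F) x i j = 'D_w ('D_w' (fun y => F y i j)) x.
  rewrite derive_mxE.
    apply: near_eq_derive; apply: open_near Ux _ => // y Uy.
    by rewrite derive_mxE//; exact: derivable_smooth Uy.
  by apply: derivable_smooth Ux; exact: smooth_on_derive.
have sFij := (smooth_on_mx F oU).1 sF i j.
pose h y := F y i j.
apply: etrans (e v u) (etrans _ (esym (e u v))).
apply: (derive_comm_real (f := h)).
- by apply: open_near Ux _ => // y Uy; exact: smooth_on_diff Uy.
- by apply: smooth_on_diff Ux; exact: smooth_on_derive.
- by apply: smooth_on_diff Ux; exact: smooth_on_derive.
Qed.

Lemma smooth_on_cst (W : normedModType R) U (a : W) : smooth_on U (fun _ : V => a).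
Proof. by move=> k; exact: diff_on_cst. Qed.

Lemma smooth_onD (W : normedModType R) U (f g : V -> W) : open U ->
  smooth_on U f -> smooth_on U g -> smooth_on U (f \+ g).
Proof. by move=> oU sf sg k; exact: diff_onD. Qed.

Lemma smooth_onM U (f g : V -> R) : open U ->
  smooth_on U f -> smooth_on U g -> smooth_on U (f \* g).
Proof. by move=> oU sf sg k; exact: diff_onM. Qed.

Lemma smooth_on_sum U (I : Type) (r : seq I) (W : normedModType R)
    (f : I -> V -> W) : open U -> (forall i, smooth_on U (f i)) ->
  smooth_on U (fun x => \sum_(i <- r) f i x).
Proof. by move=> oU sf k; apply: diff_on_sum => // i; exact: sf. Qed.

Lemma smooth_on_prod U (I : Type) (r : seq I) (f : I -> V -> R) : open U ->
  (forall i, smooth_on U (f i)) -> smooth_on U (fun x => \prod_(i <- r) f i x).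
Proof.
move=> oU sf; elim: r => [|i r IH].
  by under eq_fun do rewrite big_nil; exact: smooth_on_cst.
by under eq_fun do rewrite big_cons; apply: (@smooth_onM U (f i)).
Qed.

Lemma smooth_on_inv U (f : V -> R) : open U -> (forall x, U x -> f x != 0) ->
  smooth_on U f -> smooth_on U (fun x => (f x)^-1).
Proof.
move=> oU f0 sf; elim=> //= k IH; split=> [x Ux|v].
  by apply: differentiableV; [exact: smooth_on_diff Ux|exact: f0].
(* D_v (1 / f) = - (1 / f) (1 / f) D_v f involves no inverse but 1 / f itself,
   so that the order of differentiability can be raised by one. *)
pose g := fun x => (f x)^-1.
apply: (eq_diff_on (f := fun x => (-1) * (g x * (g x * 'D_v f x)))) => // [x Ux|].
  rewrite deriveV; [|exact: f0|exact: derivable_smooth Ux].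
  by rewrite /g mulN1r mulrA -invfM -expr2 scaleNr.
have sDf := smooth_on_derive v sf k.
by repeat (apply: diff_onM => //); exact: diff_on_cst.
Qed.

Lemma smooth_on_det m U (F : V -> 'M[R]_m) : open U ->
  (forall i j, smooth_on U (fun x => F x i j)) -> smooth_on U (fun x => \det (F x)).
Proof.
move=> oU sF; rewrite /determinant; apply: smooth_on_sum => // s.
apply: (@smooth_onM U (fun=> _)) => //; first exact: smooth_on_cst.
exact: smooth_on_prod.
Qed.

(** Cramer's rule expresses the inverse through determinants. *)
Lemma smooth_on_invmx m U (F : V -> 'M[R]_m) : open U ->
  (forall x, U x -> F x \in unitmx) -> smooth_on U F ->
  smooth_on U (fun x => invmx (F x)).
Proof.
move=> oU uF sF; have sFe := (smooth_on_mx F oU).1 sF.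
apply: (eq_smooth_on (f := fun x => (\det (F x))^-1 *: \adj (F x))) => //.
  by move=> x Ux; rewrite /invmx uF.
apply/smooth_on_mx => // i j; under eq_fun do rewrite mxE.
apply: smooth_onM => //.
  apply: smooth_on_inv => //; last exact: smooth_on_det.
  by move=> x /uF; rewrite unitmxE unitfE.
under eq_fun do rewrite mxE /cofactor.
apply: (@smooth_onM U (fun=> _)) => //; first exact: smooth_on_cst.
apply: smooth_on_det => // k l.
by under eq_fun do rewrite !mxE; exact: sFe.
Qed.

Lemma smooth_on_mulmx m p q U (F : V -> 'M[R]_(m, p)) (G : V -> 'M[R]_(p, q)) :
  open U -> smooth_on U F -> smooth_on U G -> smooth_on U (fun x => F x *m G x).
Proof.
move=> oU /(smooth_on_mx _ oU) sF /(smooth_on_mx _ oU) sG.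
apply/smooth_on_mx => // i j; under eq_fun do rewrite mxE.
by apply: smooth_on_sum => // k; exact: smooth_onM.
Qed.

Lemma smooth_on_trmx m p U (F : V -> 'M[R]_(m, p)) :
  open U -> smooth_on U F -> smooth_on U (fun x => (F x)^T).
Proof.
move=> oU /(smooth_on_mx _ oU) sF; apply/smooth_on_mx => // i j.
by under eq_fun do rewrite mxE; exact: sF.
Qed.

Lemma smooth_on_scale m p U (c : R) (F : V -> 'M[R]_(m, p)) :
  open U -> smooth_on U F -> smooth_on U (fun x => c *: F x).
Proof.
move=> oU /(smooth_on_mx _ oU) sF; apply/smooth_on_mx => // i j.
under eq_fun do rewrite mxE.
by apply: (@smooth_onM U (fun=> c)) => //; exact: smooth_on_cst.
Qed.

Lemma smooth_on_row_mx m p q U (F : V -> 'M[R]_(m, p)) (G : V -> 'M[R]_(m, q)) :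
  open U -> smooth_on U F -> smooth_on U G ->
  smooth_on U (fun x => row_mx (F x) (G x)).
Proof.
move=> oU /(smooth_on_mx _ oU) sF /(smooth_on_mx _ oU) sG.
apply/smooth_on_mx => // i j; case: (split_ordP j) => k ->.
  by under eq_fun do rewrite row_mxEl; exact: sF.
by under eq_fun do rewrite row_mxEr; exact: sG.
Qed.

End MatrixCalculus.

Lemma smooth_on_derive_field (R : realType) n p q (F : 'rV[R]_n -> 'M[R]_(p, q))
    (w : 'rV[R]_n -> 'rV[R]_n) (U : set 'rV[R]_n) :
  open U -> smooth_on U F -> smooth_on U w -> smooth_on U (fun x => 'D_(w x) F x).
Proof.
move=> oU sF /(smooth_on_mx _ oU) sw.
apply: (eq_smooth_on (f := fun x => \sum_k w x 0 k *: 'D_(delta_mx 0 k) F x)) => //.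
  move=> x Ux; have dF := smooth_on_diff sF Ux.
  rewrite deriveE// {2}[w x]row_sum_delta linear_sum /=.
  by apply: eq_bigr => k _; rewrite linearZ deriveE.
apply: smooth_on_sum => // k; apply/smooth_on_mx => // i j.
under eq_fun do rewrite mxE.
apply: smooth_onM => //.
by have /(smooth_on_derive (delta_mx 0 k))/(smooth_on_mx _ oU) := sF; exact.
Qed.

Section Jacobian.
Context {R : realType} {n m : nat}.
Implicit Types (f : 'rV[R]_n -> 'rV[R]_m) (U : set 'rV[R]_n).

Lemma smooth_on_jacobian f U :
  open U -> smooth_on U f -> smooth_on U (jacobian f).
Proof.
move=> oU sf; apply/smooth_on_mx => // i j.
have /(smooth_on_derive (delta_mx 0 i))/(smooth_on_mx _ oU)/(_ 0 j) := sf.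
apply: eq_smooth_on => // x Ux.
rewrite deriveEjacobian; first by rewrite -rowE mxE.
exact: smooth_on_diff Ux.
Qed.

(** Symmetry of second derivatives in the form used for chart changes: both
    sides are the second derivative of [f] in the directions [v] and [w]. *)
Lemma derive_jacobianC f U x v w : open U -> smooth_on U f -> U x ->
  w *m 'D_v (jacobian f) x = v *m 'D_w (jacobian f) x.
Proof.
move=> oU sf Ux.
have e a b : a *m 'D_b (jacobian f) x = 'D_b ('D_a f) x.
  transitivity ('D_b (fun y => a *m jacobian f y) x).
    rewrite derive_mulmx; first by rewrite derive_cst mul0mx add0r.
      exact: derivable_cst.
    by apply: derivable_smooth Ux; exact: smooth_on_jacobian.
  apply: near_eq_derive; apply: open_near Ux _ => // y Uy.
  by rewrite deriveEjacobian//; exact: smooth_on_diff Uy.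
by rewrite !e; exact: derive_comm Ux.
Qed.

End Jacobian.

(** * Chain rules for directional derivatives *)

Lemma is_derive_linear (R : realType) (V W : normedModType R)
    (L : {linear V -> W}) x v : continuous L ->
  is_derive x v L (L v).
Proof.
move=> cL; have dL : differentiable L x by exact: linear_differentiable.
by apply: DeriveDef; [exact: diff_derivable|rewrite (deriveE _ dL) diff_lin].
Qed.

Section DirectionalDerivatives.
Context {R : realType} {V W X : normedModType R}.

(** For a linear inner map the difference quotients of both sides coincide, so
    that derivability of [f] in the single direction [L v] is enough. *)
Lemma is_derive_comp_linear (L : {linear V -> W}) (f : W -> X) x v :
  derivable f (L x) (L v) -> is_derive x v (f \o L) ('D_(L v) f (L x)).
Proof.
have e : (fun h : R => h^-1 *: (((f \o L) \o shift x) (h *: v) - (f \o L) x)) =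
    (fun h : R => h^-1 *: ((f \o shift (L x)) (h *: L v) - f (L x))).
  by apply/funext => h; rewrite /= linearP.
by move=> df; apply: DeriveDef; rewrite /derivable /derive e.
Qed.

Lemma is_derive_linear_comp (L : {linear V -> W}) (K : {linear W -> X}) x v :
  continuous K -> is_derive x v (K \o L) (K (L v)).
Proof.
move=> cK; have [dK eK] := is_derive_linear (L x) (L v) cK.
exact: is_derive_eq (is_derive_comp_linear dK) eK.
Qed.

Lemma eq_line_is_derive (f k : V -> W) x v d :
  (forall h, f (h *: v + x) = k (h *: v + x)) ->
  is_derive x v k d -> is_derive x v f d.
Proof.
move=> fk [dk <-].
have fx : f x = k x by have := fk 0; rewrite scale0r add0r.
have e : (fun h : R => h^-1 *: ((f \o shift x) (h *: v) - f x)) =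
    (fun h : R => h^-1 *: ((k \o shift x) (h *: v) - k x)).
  by apply/funext => h /=; rewrite fk fx.
by apply: DeriveDef; rewrite /derivable /derive e.
Qed.

Lemma derive_comp (f : V -> W) (k : W -> X) x v :
  differentiable f x -> differentiable k (f x) ->
  'D_v (k \o f) x = 'D_('d f x v) k (f x).
Proof.
move=> df dk; rewrite (deriveE _ dk).
by rewrite (deriveE _ (differentiable_comp df dk)) diff_comp.
Qed.

Lemma is_derive_row_mx m p q (F : V -> 'M[R]_(m, p)) (G : V -> 'M[R]_(m, q)) x v :
  derivable F x v -> derivable G x v ->
  is_derive x v (fun y => row_mx (F y) (G y)) (row_mx ('D_v F x) ('D_v G x)).
Proof.
move=> dF dG.
have d : derivable (fun y => row_mx (F y) (G y)) x v.
  apply/derivable_mxP => i j; case: (split_ordP j) => k ->.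
    by under eq_fun do rewrite row_mxEl; exact: (derivable_mxP _ _ _).1 dF i k.
  by under eq_fun do rewrite row_mxEr; exact: (derivable_mxP _ _ _).1 dG i k.
apply: DeriveDef => //; apply/matrixP => i j; rewrite derive_mxE//.
case: (split_ordP j) => k ->.
  by rewrite row_mxEl derive_mxE//; under eq_fun do rewrite row_mxEl.
by rewrite row_mxEr derive_mxE//; under eq_fun do rewrite row_mxEr.
Qed.

End DirectionalDerivatives.

(** * Tangent vectors and chart changes *)

Section TangentVectors.
Context {R : realType} {m : nat} {X : Type} (A : atlas R m X).

Lemma tangent_tvector i p v : adom i p -> tangent_space A p v ->
  v = tvector A i p (v i).
Proof.
move=> ip [vE v0]; apply/funext => j; case: (pselect (adom j p)) => jp.
  by rewrite tvectorE// -vE.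
by rewrite (v0 _ jp) /tvector asboolF// => -[].
Qed.

Lemma tvector_id i p y : adom i p -> tvector A i p y i = y.
Proof. by move=> ip; rewrite tvectorE// atrans_id. Qed.

Lemma tangent_spaceB p v w : tangent_space A p v -> tangent_space A p w ->
  tangent_space A p (v - w).
Proof.
move=> [vE v0] [wE w0]; split=> [i j ip jp|i nip].
  by rewrite !fctE /= (vE i j)// (wE i j)// linearB.
by rewrite !fctE /= v0// w0// subr0.
Qed.

Lemma tvector_sum i p k (c : 'I_k -> R) (y : 'I_k -> 'rV[R]_m) :
  \sum_r c r *: tvector A i p (y r) = tvector A i p (\sum_r c r *: y r).
Proof.
apply/funext => j; rewrite fct_sumE /tvector.
under eq_bigr do rewrite fctE.
case: asboolP => _; last by rewrite big1// => r _; rewrite scaler0.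
by rewrite linear_sum; apply: eq_bigr => r _; rewrite linearZ.
Qed.

Lemma smooth_on_jacobian_atrans i j :
  smooth_on (acoord i @` (adom i `&` adom j)) (jacobian (atrans A i j)).
Proof. by apply: smooth_on_jacobian; [exact: atlas_open|exact: atlas_smooth]. Qed.

Lemma jacobian_atransV i j p : adom i p -> adom j p ->
  jacobian (atrans A i j) (acoord i p) *m jacobian (atrans A j i) (acoord j p) = 1%:M.
Proof.
move=> ip jp; apply/row_matrixP => k; rewrite row_mul !rowE mulmx1 -mulmxA.
rewrite mulmxA /jacobian !mul_rV_lin1.
by rewrite -(atrans_chain (i := i)) ?atrans_id.
Qed.

Lemma jacobian_atrans_unit i j p : adom i p -> adom j p ->
  jacobian (atrans A i j) (acoord i p) \in unitmx.
Proof.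
by move=> ip jp; case: (mulmx1_unit (jacobian_atransV ip jp)) => u _; exact: u.
Qed.

Lemma jacobian_atrans_inv i j p : adom i p -> adom j p ->
  jacobian (atrans A i j) (acoord i p) =
  invmx (jacobian (atrans A j i) (acoord j p)).
Proof.
move=> ip jp; have u := jacobian_atrans_unit jp ip.
by rewrite -[LHS](mulmxK u) jacobian_atransV// mul1mx.
Qed.

End TangentVectors.

(** * Chart changes of the tangent bundle *)

Section TangentCharts.
Context {R : realType} {n : nat} {M : Type} (A : atlas R n M).
Local Notation TA := (tatlas A).
Implicit Types (a b : aidx A) (u : tbundle A) (z w : 'rV[R]_(n + n)).

(** With [phi] the chart change of the base, this is the matrix
    [y^l d^2 phi^k / dx^i dx^l] (row [i], column [k]) at [z = (x, y)]: the
    inhomogeneous term in the transformation of the coefficients of a nonlinear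
    connection. *)
Definition jac_deriv a b z : 'M[R]_n :=
  'D_(rsubmx z) (jacobian (atrans A a b)) (lsubmx z).

Lemma tcoord_img_overlap a b u : tdom a u -> tdom b u ->
  (tcoord a @` (tdom a `&` tdom b)) (tcoord a u).
Proof. by move=> au bu; exists u. Qed.

Lemma lsubmx_overlap a b z : (tcoord a @` (tdom a `&` tdom b)) z ->
  (acoord a @` (adom a `&` adom b)) (lsubmx z).
Proof. by rewrite tcoord_img. Qed.

Lemma lsubmx_tcoord a u : lsubmx (tcoord a u) = acoord a (tbase u).
Proof. by rewrite row_mxKl. Qed.

Lemma near_overlap a b z (Q : 'rV[R]_(n + n) -> Prop) :
  (tcoord a @` (tdom a `&` tdom b)) z ->
  (forall y, (tcoord a @` (tdom a `&` tdom b)) y -> Q y) -> \forall y \near z, Q y.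
Proof. by move=> Uz; apply: open_near Uz; exact: tcoord_open. Qed.

Lemma atrans_tatlas a b z : (tcoord a @` (tdom a `&` tdom b)) z ->
  atrans TA a b z =
  row_mx (atrans A a b (lsubmx z)) (rsubmx z *m jacobian (atrans A a b) (lsubmx z)).
Proof.
move=> [u [au bu] <-]; have := @atrans_coord _ _ _ TA a b u au.
move=> -> /=; rewrite lsubmx_tcoord row_mxKr atrans_coord//.
rewrite /tcoord; congr row_mx; rewrite /jacobian mul_rV_lin1.
by have [uE _] := tvecP u; exact: uE.
Qed.

Lemma is_derive_jac_lsubmx a b z w : (tcoord a @` (tdom a `&` tdom b)) z ->
  is_derive z w (fun y : 'rV[R]_(n + n) => jacobian (atrans A a b) (lsubmx y))
    ('D_(lsubmx w) (jacobian (atrans A a b)) (lsubmx z)).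
Proof.
move=> /lsubmx_overlap Uz.
apply: (is_derive_comp_linear (L := lsubmx) (f := jacobian (atrans A a b))).
by apply: derivable_smooth Uz; exact: smooth_on_jacobian_atrans.
Qed.

Lemma is_derive_rsubmx z w :
  is_derive z w (fun y : 'rV[R]_(n + n) => rsubmx y) (rsubmx w).
Proof.
by apply: (is_derive_linear (L := rsubmx)); exact: continuous_rsubmx.
Qed.

(** Here symmetry of the second derivatives of the chart change enters the
    geometry. *)
Lemma jacobian_sym a b z v : (tcoord a @` (tdom a `&` tdom b)) z ->
  rsubmx z *m 'D_v (jacobian (atrans A a b)) (lsubmx z) = v *m jac_deriv a b z.
Proof.
move=> /lsubmx_overlap Uz; apply: derive_jacobianC Uz; first exact: atlas_open.
exact: atlas_smooth.
Qed.

(** With [P] the Jacobian of the base chart change and [Q := jac_deriv], the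
    induced chart change is [(x, y) |-> (phi x, y P(x))], and its differential maps
    [(xi, eta)] to [(xi P, eta P + xi Q)]. *)
Lemma diff_atrans_tatlas a b z w : (tcoord a @` (tdom a `&` tdom b)) z ->
  'd (atrans TA a b) z w =
  row_mx (lsubmx w *m jacobian (atrans A a b) (lsubmx z))
    (rsubmx w *m jacobian (atrans A a b) (lsubmx z) + lsubmx w *m jac_deriv a b z).
Proof.
move=> Uz; have Uz' := lsubmx_overlap Uz.
rewrite -deriveE; last exact: smooth_on_diff (@atlas_smooth _ _ _ TA a b) Uz.
have dphi : differentiable (atrans A a b) (lsubmx z).
  exact: smooth_on_diff (@atlas_smooth _ _ _ A a b) Uz'.
have [d1 e1] := @is_derive_comp_linear _ _ _ _ lsubmx _ z w
  (@diff_derivable _ _ _ _ _ (lsubmx w) dphi).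
have dJ := is_derive_jac_lsubmx w Uz; have dr := is_derive_rsubmx z w.
have d2 := is_derive_mulmx (@ex_derive _ _ _ _ _ _ _ dr) (@ex_derive _ _ _ _ _ _ _ dJ).
have [_ e2] := is_derive_row_mx d1 (@ex_derive _ _ _ _ _ _ _ d2).
have e : \forall y \near z, atrans TA a b y =
    row_mx ((atrans A a b \o lsubmx) y) (rsubmx y *m jacobian (atrans A a b) (lsubmx y)).
  by apply: near_overlap Uz _ => y Uy; exact: atrans_tatlas.
rewrite (near_eq_derive w e) e2 e1 deriveEjacobian//; congr row_mx.
by rewrite (@derive_val _ _ _ _ _ _ _ d2) !derive_val jacobian_sym.
Qed.

Lemma vertical_lsubmx a u w : tdom a u ->
  'd (acoord a \o tbase \o tinv a) (tcoord a u) w = lsubmx w.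
Proof.
move=> au; have Uz := tcoord_img_overlap au au.
have c : continuous (lsubmx : 'rV[R]_(n + n) -> 'rV[R]_n) by exact: continuous_lsubmx.
have e : \forall y \near tcoord a u, lsubmx y = (acoord a \o tbase \o tinv (A := A) a) y.
  by apply: near_overlap Uz _ => _ [q [aq _] <-]; rewrite /= lsubmx_tcoord atlas_coordK.
have dl : differentiable (lsubmx : 'rV[R]_(n + n) -> 'rV[R]_n) (tcoord a u).
  exact: linear_differentiable.
rewrite -deriveE; last exact: near_eq_differentiable dl.
by rewrite -(near_eq_derive w e) deriveE ?diff_lin.
Qed.

Lemma verticalP a u (t : aidx TA -> 'rV[R]_(n + n)) :
  tdom a u -> tangent_space TA u t -> vertical u t <-> lsubmx (t a) = 0.
Proof.
move=> au tt; split=> [[_ /(_ a au)]|ta]; first by rewrite vertical_lsubmx.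
split=> // b bu; rewrite vertical_lsubmx//.
have -> : t b = 'd (atrans TA a b) (tcoord a u) (t a) by have [tE _] := tt; exact: tE.
by rewrite diff_atrans_tatlas ?row_mxKl ?ta ?mul0mx//; exact: tcoord_img_overlap.
Qed.

End TangentCharts.

(** * The canonical matrix *)

Section CanonicalMatrix.
Context {R : realType} {n : nat}.
Implicit Types (g Sg E P Q : 'M[R]_n).

(** The transpose of the matrix of coefficients [N^i_j], with [g] the value of
    the metric, [Sg] its derivative along the semispray and [E] the matrix with
    entry [dG^i / dy^k] in row [k] and column [i]. The transpose is the matrix that
    acts on row vectors. *)
Definition canonical_mx g Sg E : 'M[R]_n :=
  2^-1 *: (Sg *m invmx g + E - g *m E^T *m invmx g).

(** The transformation law of nonlinear connections is a consequence of those of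
    its ingredients: [E] contributes [Q / 2], and so does [Sg], while the terms
    [P gb Q^T] arising from [Sg] and from [g E^T] cancel. *)
Lemma canonical_mx_trans P Q ga Sa Ea gb Sb Eb :
  P \in unitmx -> gb \in unitmx -> ga \in unitmx ->
  ga = P *m gb *m P^T -> Ea *m P = P *m Eb + Q ->
  Sa = Q *m gb *m P^T + P *m Sb *m P^T + P *m gb *m Q^T ->
  canonical_mx ga Sa Ea *m P = P *m canonical_mx gb Sb Eb + Q.
Proof.
move=> uP ugb uga gE EE SE.
have PKP : P^T *m invmx ga *m P = invmx gb.
  apply: (can_inj (mulKmx ugb)); rewrite mulmxV//.
  apply: (can_inj (mulKmx uP)); rewrite mulmx1 !mulmxA -gE mulmxV//.
  by rewrite mul1mx.
have e1 : Sa *m invmx ga *m P =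
    Q + P *m Sb *m invmx gb + P *m gb *m Q^T *m invmx ga *m P.
  rewrite SE !mulmxDl -!(mulmxA _ P^T) -!(mulmxA _ (P^T *m _)) PKP.
  by rewrite mulmxK// mulmxA.
have e2 : ga *m Ea^T *m invmx ga *m P =
    P *m gb *m Eb^T *m invmx gb + P *m gb *m Q^T *m invmx ga *m P.
  rewrite gE -(mulmxA _ P^T) -trmx_mul EE linearD /= trmx_mul -gE.
  rewrite mulmxDr !mulmxDl; congr (_ + _).
  by rewrite -!mulmxA (mulmxA P^T) PKP.
rewrite /canonical_mx -!scalemxAl -scalemxAr mulmxBl mulmxDl e1 e2 EE.
rewrite mulmxBr mulmxDr !mulmxA.
set x1 := P *m Sb *m _; set x2 := P *m gb *m Q^T *m _ *m _.
set x3 := P *m gb *m _ *m _; set x4 := P *m Eb.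
apply/matrixP => i j; rewrite !mxE; lra.
Qed.

(** The terms in [E] are skew: they contribute [(E g - g E^T) / 2] and its
    opposite. *)
Lemma canonical_mx_metric g Sg E : g \in unitmx -> g^T = g -> Sg^T = Sg ->
  Sg = canonical_mx g Sg E *m g + g *m (canonical_mx g Sg E)^T.
Proof.
move=> ug gT ST; set L := canonical_mx g Sg E.
have Lg : L *m g = 2^-1 *: (Sg + E *m g - g *m E^T).
  by rewrite -scalemxAl mulmxBl mulmxDl !mulmxKV.
have -> : g *m L^T = (L *m g)^T by rewrite trmx_mul gT.
rewrite Lg !linearZ /= !linearB !linearD /= !trmx_mul trmxK ST gT.
by apply/matrixP => i j; rewrite !mxE; lra.
Qed.

Lemma canonical_mx_obata g Sg E i j :
  g^T = g -> Sg^T = Sg ->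
  (canonical_mx g Sg E)^T i j = 2^-1 * (\sum_k invmx g i k * Sg k j)
    + \sum_k \sum_s obata g i k s j * E k s.
Proof.
move=> gT ST; set V := invmx g.
have VT : V^T = V by rewrite /V trmx_inv gT.
have -> : (canonical_mx g Sg E)^T = 2^-1 *: (V *m Sg + E^T - V *m E *m g).
  rewrite linearZ linearB linearD /= !trmx_mul trmxK gT ST -/V VT.
  by rewrite mulmxA.
have -> : \sum_k \sum_s obata g i k s j * E k s =
    2^-1 * (E j i - (V *m E *m g) i j).
  transitivity (\sum_k \sum_s (2^-1 * ((i == s)%:R * (k == j)%:R * E k s)
      - 2^-1 * (V i k * E k s * g s j))).
    by apply: eq_bigr => k _; apply: eq_bigr => s _; rewrite /obata -/V; ring.
  under eq_bigr do rewrite sumrB -!mulr_sumr.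
  rewrite sumrB -!mulr_sumr -mulrBr; congr (_ * (_ - _)).
    rewrite (bigD1 j)//= (bigD1 i)//= !eqxx !mul1r !big1 ?addr0//.
      by move=> k /negPf kj; rewrite big1// => s _; rewrite kj mulr0 mul0r.
    by move=> s /negPf si; rewrite eq_sym si !mul0r.
  rewrite exchange_big mxE /=; apply: eq_bigr => s _.
  by rewrite mxE mulr_suml.
by rewrite !mxE; ring.
Qed.

End CanonicalMatrix.

(** * The canonical coefficients in the induced charts *)

Section CanonicalCoefficients.
Context {R : realType} {n : nat} {M : Type} (A : atlas R n M).
Local Notation TA := (tatlas A).
Context (S : tbundle A -> aidx TA -> 'rV[R]_(n + n)).
Context (g : aidx A -> 'rV[R]_(n + n) -> 'M[R]_n).
Context (hS : semispray S) (hg : gen_lagrange_metric g).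
Implicit Types (a b : aidx A) (u : tbundle A) (z w : 'rV[R]_(n + n)).

Definition spray_mx a z : 'M[R]_n :=
  \matrix_(k, i) dy k (fun z' => spray_coef S a z' 0 i) z.

Definition metric_deriv a z : 'M[R]_n := 'D_(S (tinv a z) a) (g a) z.

Definition canonical_coef a z : 'M[R]_n :=
  canonical_mx (g a z) (metric_deriv a z) (spray_mx a z).

Lemma aimg_tatlas a : aimg TA a = tcoord a @` (tdom a `&` tdom a).
Proof. by rewrite setIid. Qed.

Lemma open_aimg a : open (aimg TA a).
Proof. by rewrite aimg_tatlas; exact: tcoord_open. Qed.

Lemma overlap_aimg a b : tcoord a @` (tdom a `&` tdom b) `<=` aimg TA a.
Proof. by move=> _ [u [au _] <-]; exists u. Qed.

Lemma atrans_aimg a b z : (tcoord a @` (tdom a `&` tdom b)) z ->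
  aimg TA b (atrans TA a b z).
Proof.
move=> [u [au bu] <-]; exists u => //.
by rewrite (@atrans_coord _ _ _ TA a b u au).
Qed.

Lemma smooth_on_spray a : smooth_on (aimg TA a) (fun z => S (tinv a z) a).
Proof. by have [[_ sS] _] := hS; have := sS a; rewrite setIT. Qed.

Lemma spray_row a z : aimg TA a z ->
  S (tinv a z) a = row_mx (rsubmx z) (- 2 *: spray_coef S a z).
Proof.
move=> [u au <-]; rewrite -[LHS]hsubmxK /spray_coef scalerA mulNr mulrN opprK divff//.
rewrite scale1r (@tcoordK _ _ _ A a u au); congr row_mx.
have [_ /(_ a u au)] := hS.
by rewrite /tangent_structure /liouville => /eq_row_mx[].
Qed.

Lemma smooth_on_spray_coef a : smooth_on (aimg TA a) (spray_coef S a).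
Proof.
have oU := @open_aimg a; apply: smooth_on_scale => //.
apply/smooth_on_mx => // i j.
have /(smooth_on_mx _ oU)/(_ i (rshift n j)) := @smooth_on_spray a.
by apply: eq_smooth_on => // x _; rewrite mxE.
Qed.

Lemma spray_trans a b z : (tcoord a @` (tdom a `&` tdom b)) z ->
  S (tinv b (atrans TA a b z)) b = 'd (atrans TA a b) z (S (tinv a z) a).
Proof.
move=> [u [au bu] <-]; rewrite (@atrans_coord _ _ _ TA a b u au).
rewrite (@tcoordK _ _ _ A a u au) [tinv b _](@tcoordK _ _ _ A b u bu).
by have [[+ _] _] := hS => /(_ u I)[+ _]; exact.
Qed.

(** This is the equality of the vertical components in
    [S_b = d(atrans) S_a]. *)
Lemma spray_coef_trans a b z : (tcoord a @` (tdom a `&` tdom b)) z ->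
  spray_coef S b (atrans TA a b z) =
  spray_coef S a z *m jacobian (atrans A a b) (lsubmx z)
  - 2^-1 *: (rsubmx z *m jac_deriv a b z).
Proof.
move=> Uz; rewrite {1}/spray_coef spray_trans// diff_atrans_tatlas//.
rewrite spray_row; last exact: overlap_aimg Uz.
rewrite !row_mxKl !row_mxKr scalerDr -scalemxAl scalerA mulrNN mulVf//.
by rewrite scale1r scaleNr.
Qed.

Lemma spray_mx_mul a z v : aimg TA a z ->
  v *m spray_mx a z = 'D_(row_mx 0 v) (spray_coef S a) z.
Proof.
move=> Uz; have dG := smooth_on_diff (@smooth_on_spray_coef a) Uz.
rewrite deriveE// mulmx_sum_row {2}[v]row_sum_delta.
have -> : row_mx 0 (\sum_k v 0 k *: delta_mx 0 k) =
    \sum_k v 0 k *: row_mx 0 (delta_mx 0 k) :> 'rV[R]_(n + n).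
  rewrite -[LHS]add0r; elim/big_rec2: _ => [|k x y _ <-].
    by rewrite row_mx0 addr0.
  by rewrite scale_row_mx scaler0 !add0r add_row_mx add0r.
rewrite linear_sum; apply: eq_bigr => k _; rewrite linearZ /=; congr (_ *: _).
apply/rowP => i; rewrite !mxE /dy -deriveE// derive_mxE//.
exact: diff_derivable.
Qed.

(** On the line through [z] in the vertical direction [v] the base point is
    fixed, and [jac_deriv] is linear in the vertical coordinate. *)
Lemma is_derive_jac_deriv a b z v : (tcoord a @` (tdom a `&` tdom b)) z ->
  is_derive z (row_mx 0 v) (@jac_deriv R n M A a b)
    ('D_v (jacobian (atrans A a b)) (lsubmx z)).
Proof.
move=> Uz; have Uz' := lsubmx_overlap Uz; set P := jacobian _.
have dP : differentiable P (lsubmx z).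
  by apply: smooth_on_diff Uz'; exact: smooth_on_jacobian_atrans.
have cd : continuous ('d P (lsubmx z)) by exact: diff_continuous.
have d := @is_derive_linear_comp _ _ _ _ rsubmx _ z (row_mx 0 v) cd.
rewrite [X in is_derive _ _ _ X](deriveE _ dP).
have e : 'd P (lsubmx z) (rsubmx (row_mx (0 : 'rV[R]_n) v)) = 'd P (lsubmx z) v.
  by rewrite row_mxKr.
apply: eq_line_is_derive (is_derive_eq d e) => h; rewrite /jac_deriv /=.
have -> : lsubmx (h *: row_mx 0 v + z) = lsubmx z.
  by rewrite linearP /= row_mxKl scaler0 add0r.
exact: deriveE.
Qed.

(** Differentiating [spray_coef_trans] in the vertical direction [v], the term
    [y Q / 2] is quadratic in [y]: by symmetry of second derivatives its derivative
    is [v Q] and not [v Q / 2]. *)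
Lemma spray_mx_trans a b z : (tcoord a @` (tdom a `&` tdom b)) z ->
  spray_mx a z *m jacobian (atrans A a b) (lsubmx z) =
  jacobian (atrans A a b) (lsubmx z) *m spray_mx b (atrans TA a b z) +
  jac_deriv a b z.
Proof.
move=> Uz; have aUz := overlap_aimg Uz; have bUz := atrans_aimg Uz.
set P := jacobian _; apply/row_matrixP => k.
rewrite !rowE mulmxDr !mulmxA; set v := delta_mx 0 k.
rewrite !spray_mx_mul//.
have dT := smooth_on_diff (@atlas_smooth _ _ _ TA a b) Uz.
have dGb := smooth_on_diff (@smooth_on_spray_coef b) bUz.
have dGa : derivable (spray_coef S a) z (row_mx 0 v).
  by apply: derivable_smooth aUz; exact: smooth_on_spray_coef.
have := derive_comp (row_mx 0 v) dT dGb.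
rewrite diff_atrans_tatlas// row_mxKl row_mxKr !mul0mx addr0 => <-.
have e : \forall y \near z, (spray_coef S b \o atrans TA a b) y =
   spray_coef S a y *m P (lsubmx y) - 2^-1 *: (rsubmx y *m jac_deriv a b y).
  by apply: near_overlap Uz _ => y Uy; exact: spray_coef_trans.
rewrite (near_eq_derive _ e).
have dP := is_derive_jac_lsubmx (row_mx 0 v) Uz.
have dr := is_derive_rsubmx z (row_mx 0 v).
have dQ := is_derive_jac_deriv v Uz.
have d1 := is_derive_mulmx dGa (@ex_derive _ _ _ _ _ _ _ dP).
have d2 := is_derive_mulmx (@ex_derive _ _ _ _ _ _ _ dr) (@ex_derive _ _ _ _ _ _ _ dQ).
have d3 := is_deriveB d1 (is_deriveZ 2^-1 d2).
rewrite (@derive_val _ _ _ _ _ _ _ d3).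
rewrite (@derive_val _ _ _ _ _ _ _ dP) (@derive_val _ _ _ _ _ _ _ dr).
rewrite (@derive_val _ _ _ _ _ _ _ dQ).
rewrite row_mxKl row_mxKr derive0 mulmx0 addr0 jacobian_sym//.
by rewrite -mulr2n -[X in _ *: X]scaler_nat scalerA mulVf// scale1r subrK.
Qed.

Lemma metric_unit a z : aimg TA a z -> g a z \in unitmx.
Proof. by move=> Uz; rewrite -row_free_unit /row_free (hg.2 a z Uz).2. Qed.

Lemma smooth_on_metric a : smooth_on (aimg TA a) (g a).
Proof. by apply/smooth_on_mx => [|i j]; [exact: open_aimg|exact: hg.1.1]. Qed.

Lemma metric_trans a b z : (tcoord a @` (tdom a `&` tdom b)) z ->
  g a z = jacobian (atrans A a b) (lsubmx z) *m g b (atrans TA a b z) *m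
    (jacobian (atrans A a b) (lsubmx z))^T.
Proof.
move=> [u [au bu] <-]; rewrite (@atrans_coord _ _ _ TA a b u au) lsubmx_tcoord.
exact: hg.1.2.
Qed.

(** The Leibniz rule for [g_a = P g_b P^T]: the base component of the semispray
    at [(x, y)] is [y], so its derivative of [P] is [jac_deriv]. *)
Lemma metric_deriv_trans a b z : (tcoord a @` (tdom a `&` tdom b)) z ->
  let P := jacobian (atrans A a b) (lsubmx z) in
  let Q := jac_deriv a b z in
  let gb := g b (atrans TA a b z) in
  metric_deriv a z = Q *m gb *m P^T + P *m metric_deriv b (atrans TA a b z) *m P^T
    + P *m gb *m Q^T.
Proof.
move=> Uz P Q gb; have aUz := overlap_aimg Uz; have bUz := atrans_aimg Uz.
rewrite /metric_deriv; set s := S (tinv a z) a.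
have dT := smooth_on_diff (@atlas_smooth _ _ _ TA a b) Uz.
have dgb := smooth_on_diff (@smooth_on_metric b) bUz.
have e : \forall y \near z, g a y =
    jacobian (atrans A a b) (lsubmx y) *m (g b \o atrans TA a b) y *m
    (jacobian (atrans A a b) (lsubmx y))^T.
  by apply: near_overlap Uz _ => y Uy; exact: metric_trans.
have dP := is_derive_jac_lsubmx s Uz.
have dPs := @ex_derive _ _ _ _ _ _ _ dP.
have dgs : derivable (g b \o atrans TA a b) z s.
  by apply: diff_derivable; exact: differentiable_comp.
have d1 := is_derive_mulmx dPs dgs.
have d2 := is_derive_mulmx (@ex_derive _ _ _ _ _ _ _ d1) (derivable_trmx dPs).
rewrite (near_eq_derive _ e) (@derive_val _ _ _ _ _ _ _ d2).
rewrite (@derive_val _ _ _ _ _ _ _ d1) (derive_trmx dPs).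
rewrite (derive_comp s dT dgb).
rewrite (@derive_val _ _ _ _ _ _ _ dP) (spray_trans Uz) mulmxDl.
by rewrite /s (spray_row aUz) row_mxKl.
Qed.

Lemma canonical_coef_trans a b z : (tcoord a @` (tdom a `&` tdom b)) z ->
  canonical_coef a z *m jacobian (atrans A a b) (lsubmx z) =
  jacobian (atrans A a b) (lsubmx z) *m canonical_coef b (atrans TA a b z)
  + jac_deriv a b z.
Proof.
move=> Uz; apply: canonical_mx_trans.
- have [p [ap bp] <-] := lsubmx_overlap Uz; exact: jacobian_atrans_unit.
- exact: metric_unit (atrans_aimg Uz).
- exact: metric_unit (overlap_aimg Uz).
- exact: metric_trans.
- exact: spray_mx_trans.
- exact: metric_deriv_trans.
Qed.

Lemma smooth_on_canonical_coef a : smooth_on (aimg TA a) (canonical_coef a).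
Proof.
have oU := @open_aimg a; have sg := @smooth_on_metric a.
have sV : smooth_on (aimg TA a) (fun z => invmx (g a z)).
  by apply: smooth_on_invmx => // z; exact: metric_unit.
have sD : smooth_on (aimg TA a) (metric_deriv a).
  by apply: smooth_on_derive_field => //; exact: smooth_on_spray.
have sE : smooth_on (aimg TA a) (spray_mx a).
  apply/smooth_on_mx => // k i; under eq_fun do rewrite mxE.
  apply: smooth_on_derive.
  by have /(smooth_on_mx _ oU) := @smooth_on_spray_coef a; exact.
apply: smooth_on_scale => //; apply: smooth_onD => //; first apply: smooth_onD => //.
  exact: smooth_on_mulmx.
have -> : (fun z => - (g a z *m (spray_mx a z)^T *m invmx (g a z))) =
    (fun z => -1 *: (g a z *m (spray_mx a z)^T *m invmx (g a z))).
  by apply/funext => z; rewrite scaleN1r.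
apply: smooth_on_scale => //; apply: smooth_on_mulmx => //.
by apply: smooth_on_mulmx => //; exact: smooth_on_trmx.
Qed.

End CanonicalCoefficients.

(** * Nonlinear connections from their local coefficients *)

Section Horizontal.
Context {R : realType} {n : nat} {M : Type} (A : atlas R n M).
Local Notation TA := (tatlas A).
Context (L : aidx A -> 'rV[R]_(n + n) -> 'M[R]_n).
Implicit Types (a b : aidx A) (u : tbundle A) (z w : 'rV[R]_(n + n)).

(** The transformation law of the transposed coefficients of a nonlinear
    connection. *)
Definition connection_law := forall a b z, (tcoord a @` (tdom a `&` tdom b)) z ->
  L a z *m jacobian (atrans A a b) (lsubmx z) =
  jacobian (atrans A a b) (lsubmx z) *m L b (atrans TA a b z) + jac_deriv a b z.

Definition horizontal u : set (aidx TA -> 'rV[R]_(n + n)) :=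
  [set w | tangent_space TA u w /\
     forall a, tdom a u -> rsubmx (w a) = - (lsubmx (w a) *m L a (tcoord a u))].

Definition horizontal_lift a u (xi : 'rV[R]_n) : aidx TA -> 'rV[R]_(n + n) :=
  tvector TA a u (row_mx xi (- (xi *m L a (tcoord a u)))).

Context (hL : connection_law) (sL : forall a, smooth_on (aimg TA a) (L a)).

(** The transformation law says exactly that the horizontal lifts computed in two
    charts agree. *)
Lemma horizontal_lift_coord a b u xi : tdom a u -> tdom b u ->
  let xi' := xi *m jacobian (atrans A a b) (acoord a (tbase u)) in
  horizontal_lift a u xi b = row_mx xi' (- (xi' *m L b (tcoord b u))).
Proof.
move=> au bu xi'; have Uz := tcoord_img_overlap au bu.
rewrite /horizontal_lift (@tvectorE _ _ _ TA a u _ b au bu).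
rewrite [LHS](diff_atrans_tatlas _ Uz) row_mxKl row_mxKr mulNmx.
rewrite -(mulmxA xi) (hL Uz) (@atrans_coord _ _ _ TA a b u au) lsubmx_tcoord.
by rewrite mulmxDr opprD addrNK mulmxA.
Qed.

Lemma horizontal_lift_horizontal a u xi : tdom a u ->
  horizontal u (horizontal_lift a u xi).
Proof.
move=> au; split=> [|b bu]; first exact: tvectorP.
by rewrite (horizontal_lift_coord xi au bu) row_mxKl row_mxKr.
Qed.

Lemma horizontal_lift_id a u xi : tdom a u ->
  horizontal_lift a u xi a = row_mx xi (- (xi *m L a (tcoord a u))).
Proof. by move=> au; rewrite /horizontal_lift (@tvector_id _ _ _ TA a u _ au). Qed.

Lemma horizontalE a u t : tdom a u -> horizontal u t ->
  t = horizontal_lift a u (lsubmx (t a)).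
Proof.
move=> au [tt /(_ a au) ta]; rewrite {1}(@tangent_tvector _ _ _ TA a u t au tt).
by rewrite /horizontal_lift -ta hsubmxK.
Qed.

Lemma horizontal_lift0 a u : horizontal_lift a u 0 = 0.
Proof.
rewrite /horizontal_lift mul0mx oppr0 row_mx0; apply/funext => b; rewrite /tvector.
by case: asboolP; rewrite ?linear0.
Qed.

Lemma horizontal_lift_sum a u (c : 'I_n -> R) :
  \sum_r c r *: horizontal_lift a u (delta_mx 0 r) = horizontal_lift a u (\row_r c r).
Proof.
rewrite /horizontal_lift tvector_sum; congr tvector.
have -> : \row_r c r = \sum_r c r *: delta_mx 0 r.
  by rewrite [LHS]row_sum_delta; apply: eq_bigr => r _; rewrite mxE.
rewrite mulmx_suml -sumrN; elim/big_rec3: _ => [|r x y t _ ->].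
  by rewrite row_mx0.
by rewrite scale_row_mx add_row_mx -scalemxAl scalerN.
Qed.

Lemma smooth_horizontal_lift a xi :
  smooth_field TA (@tdom R n M A a) (fun u => horizontal_lift a u xi).
Proof.
split=> [u _|b]; first exact: tvectorP.
set U := (X in smooth_on X _).
have UE : U = @tcoord R n M A b @` (@tdom R n M A b `&` @tdom R n M A a) by [].
have oU : open U by rewrite UE; exact: tcoord_open.
(* In the chart b, the Jacobian of the change from a to b is the inverse of
   that of the change from b to a, whose smoothness in b is part of the
   atlas. *)
pose P (z : 'rV[R]_(n + n)) := invmx (jacobian (atrans A b a) (lsubmx z)).
apply: (eq_smooth_on (f := fun z => row_mx (xi *m P z) (- (xi *m P z *m L b z)))) => //.
  move=> _ [u [bu au] <-].
  have -> : ainv (a := TA) b (acoord (a := TA) b u) = u by exact: (atlas_coordK (a := TA) bu).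
  by rewrite (horizontal_lift_coord xi au bu) (jacobian_atrans_inv au bu) /P lsubmx_tcoord.
have sP : smooth_on U P.
  rewrite UE tcoord_img.
  apply: (smooth_on_comp_linear (L := lsubmx)
    (f := fun x => invmx (jacobian (atrans A b a) x))).
  - exact: atlas_open.
  - exact: continuous_lsubmx.
  - apply: smooth_on_invmx; first exact: atlas_open.
      by move=> _ [p [bp ap] <-]; exact: jacobian_atrans_unit.
    exact: smooth_on_jacobian_atrans.
have sxP : smooth_on U (fun z => xi *m P z).
  by apply: smooth_on_mulmx => //; exact: smooth_on_cst.
apply: smooth_on_row_mx => //.
have -> : (fun z => - (xi *m P z *m L b z)) = (fun z => -1 *: (xi *m P z *m L b z)).
  by apply/funext => z; rewrite scaleN1r.
apply: smooth_on_scale => //; apply: smooth_on_mulmx => //.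
apply: smooth_on_sub (@sL b); rewrite UE; exact: overlap_aimg.
Qed.

Lemma split_horizontal a u t : tdom a u -> tangent_space TA u t ->
  vertical u (t - horizontal_lift a u (lsubmx (t a))).
Proof.
move=> au tt; have th : tangent_space TA u (horizontal_lift a u (lsubmx (t a))).
  exact: tvectorP.
apply/(verticalP au (tangent_spaceB tt th)).
by rewrite !fctE /= (horizontal_lift_id _ au) linearB /= row_mxKl subrr.
Qed.

Lemma horizontal_connection : nonlinear_connection horizontal.
Proof.
split=> [u|u|u t tt].
- have [a au] := tdom_cover u.
  exists (@tdom R n M A a), (fun r u => horizontal_lift a u (delta_mx 0 r)); split=> //.
  + by move=> b; exact: tcoord_open.
  + by move=> r; exact: smooth_horizontal_lift.
  + move=> q aq; split.
      apply/seteqP; split=> [t ht|_ [c ->]].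
        exists (fun r => lsubmx (t a) 0 r); rewrite horizontal_lift_sum {1}(horizontalE aq ht).
        by congr horizontal_lift; apply/rowP => r; rewrite mxE.
      by rewrite horizontal_lift_sum; exact: horizontal_lift_horizontal.
    move=> c; rewrite horizontal_lift_sum => /(congr1 (fun t => lsubmx (t a))).
    rewrite (horizontal_lift_id _ aq) row_mxKl => c0 r.
    by have := congr1 (fun v : 'rV_n => v 0 r) c0; rewrite !mxE.
- have [a au] := tdom_cover u.
  apply/seteqP; split=> [t [ht vt]|_ ->].
    have ta := (verticalP au ht.1).1 vt.
    by rewrite (horizontalE au ht) ta horizontal_lift0.
  have t0 : tangent_space TA u 0 by rewrite -(horizontal_lift0 a u); exact: tvectorP.
  split; first by rewrite -(horizontal_lift0 a u); exact: horizontal_lift_horizontal.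
  by apply/(verticalP au t0); rewrite linear0.
- have [a au] := tdom_cover u.
  exists (horizontal_lift a u (lsubmx (t a))),
    (t - horizontal_lift a u (lsubmx (t a))); split.
  + exact: horizontal_lift_horizontal.
  + exact: split_horizontal.
  + by rewrite addrC subrK.
Qed.

Lemma conn_coef_horizontal a z : aimg TA a z ->
  conn_coef horizontal a z = (L a z)^T.
Proof.
move=> [u au <-]; apply/matrixP => i j; rewrite [LHS]mxE [RHS]mxE.
rewrite [tinv a _](@tcoordK _ _ _ A a u au).
set t := coord_field_x a j u.
have tt : tangent_space TA u t by exact: tvectorP.
have ta : t a = row_mx (delta_mx 0 j) 0 by exact: (@tvector_id _ _ _ TA a u _ au).
have [ht vt] : [set v | horizontal u v /\ vertical u (t - v)] (hproj horizontal u t).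
  apply: xgetPex; exists (horizontal_lift a u (lsubmx (t a))).
  by split; [exact: horizontal_lift_horizontal|exact: split_horizontal].
set v := hproj _ _ _ in ht vt *.
have := (verticalP au (tangent_spaceB tt ht.1)).1 vt.
rewrite !fctE /= linearB /= ta row_mxKl => /subr0_eq lv.
by rewrite (ht.2 a au) -lv -rowE !mxE opprK.
Qed.

End Horizontal.

(** * Metric connections *)

Section MetricConnection.
Context {R : realType} {n : nat} {M : Type} (A : atlas R n M).
Local Notation TA := (tatlas A).
Local Notation field := (tbundle A -> aidx TA -> 'rV[R]_(n + n)).
Context (S : field) (N : tbundle A -> set (aidx TA -> 'rV[R]_(n + n))).
Context (g L : aidx A -> 'rV[R]_(n + n) -> 'M[R]_n).
Implicit Types (F : field) (W : set (tbundle A)) (a : aidx A).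

Lemma metric_formE F1 F2 a z :
  metric_form g F1 F2 a z = (vcomp F1 a z *m g a z *m (vcomp F2 a z)^T) 0 0.
Proof.
rewrite mxE /metric_form exchange_big /=; apply: eq_bigr => j _.
rewrite !mxE mulr_suml; apply: eq_bigr => i _.
by rewrite [g a z i j * _]mulrC.
Qed.

Lemma derivable_vcomp F W a u v : smooth_field TA W F ->
  tdom a u -> W u -> derivable (vcomp F a) (tcoord a u) v.
Proof.
move=> [_ /(_ a) sF] au Wu.
have Uz : (tcoord a @` (tdom a `&` W)) (tcoord a u) by exists u.
apply/derivable_mxP => i j.
have -> : (fun y => vcomp F a y i j) = (fun y => F (tinv a y) a i (rshift n j)).
  by apply/funext => y; rewrite mxE.
have /derivable_mxP := @derivable_smooth _ _ _ _ _ _ v sF Uz.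
exact.
Qed.

Context (hN : forall a z, aimg TA a z -> conn_coef N a z = (L a z)^T).

Lemma vcomp_dyn_deriv F a u : tdom a u -> derivable (vcomp F a) (tcoord a u) (S u a) ->
  vcomp (dyn_deriv S N F) a (tcoord a u) =
  'D_(S u a) (vcomp F a) (tcoord a u) + vcomp F a (tcoord a u) *m L a (tcoord a u).
Proof.
move=> au dF; rewrite {1}/vcomp (@tcoordK _ _ _ A a u au) /dyn_deriv asboolT//.
rewrite row_mxKr; apply/rowP => i; rewrite !mxE.
rewrite /field_deriv (@tcoordK _ _ _ A a u au) derive_mxE//; congr (_ + _).
apply: eq_bigr => j _; rewrite hN; last by exists u.
by rewrite [_^T _ _]mxE.
Qed.

Context (sg : forall a, smooth_on (aimg TA a) (g a)).
Context (hLg : forall a z, aimg TA a z ->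
  'D_(S (tinv a z) a) (g a) z = L a z *m g a z + g a z *m (L a z)^T).

(** By the Leibniz rule the derivatives of the components of the two fields
    cancel, and the hypothesis on [L] is what remains. *)
Lemma metric_connectionP : metric_connection S N g.
Proof.
move=> W F1 F2 _ [sF1 _] [sF2 _] a u au Wu; rewrite /dyn_deriv_metric.
have Uz : aimg TA a (tcoord a u) by exists u.
have gz := hLg Uz.
rewrite /field_deriv (@tcoordK _ _ _ A a u au) in gz *.
set z := tcoord a u in Uz gz *; set s := S u a in gz *.
have d1 : derivable (vcomp F1 a) z s by exact: derivable_vcomp sF1 au Wu.
have d2 : derivable (vcomp F2 a) z s by exact: derivable_vcomp sF2 au Wu.
have dg : derivable (g a) z s by apply: derivable_smooth Uz; exact: sg.
have D1 := is_derive_mulmx d1 dg.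
have D2 := is_derive_mulmx (@ex_derive _ _ _ _ _ _ _ D1) (derivable_trmx d2).
rewrite !metric_formE (vcomp_dyn_deriv au d1) (vcomp_dyn_deriv au d2).
have -> : metric_form g F1 F2 a =
    (fun y => (vcomp F1 a y *m g a y *m (vcomp F2 a y)^T) 0 0).
  by apply/funext => y; exact: metric_formE.
rewrite -(derive_mxE _ _ (@ex_derive _ _ _ _ _ _ _ D2)).
rewrite (@derive_val _ _ _ _ _ _ _ D2) (@derive_val _ _ _ _ _ _ _ D1).
rewrite (derive_trmx d2) gz -/z -/s.
rewrite [(_ + vcomp _ _ _ *m _)^T]linearD /= trmx_mul !(mulmxDl, mulmxDr) !mulmxA.
have addE (B C : 'M[R]_1) : (B + C) 0 0 = B 0 0 + C 0 0 by rewrite mxE.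
rewrite !addE; ring.
Qed.

End MetricConnection.

(** * The canonical metric connection *)

Theorem theorem2p2 (R : realType) (n : nat) (M : topologicalType)
    (A : atlas R n M)
    (S : tbundle A -> aidx (tatlas A) -> 'rV[R]_(n + n))
    (g : aidx A -> 'rV[R]_(n + n) -> 'M[R]_n)
    (hM : smooth_manifold A) (hS : semispray S) (hg : gen_lagrange_metric g) :
  exists N : tbundle A -> set (aidx (tatlas A) -> 'rV[R]_(n + n)),
    [/\ nonlinear_connection N, metric_connection S N g &
     forall (a : aidx A) (z : 'rV[R]_(n + n)), aimg (tatlas A) a z ->
     forall i j : 'I_n,
       conn_coef N a z i j =
         2^-1 * (\sum_k invmx (g a z) i k *
                   field_deriv S a (fun z' => g a z' k j) z)
         + \sum_k \sum_s obata (g a z) i k s j *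
                   dy k (fun z' => spray_coef S a z' 0 s) z].
Proof.
pose L := canonical_coef S g.
have lawL : connection_law L by move=> a b z; exact: canonical_coef_trans.
have sL (a : aidx A) : smooth_on (aimg (tatlas A) a) (L a).
  exact: smooth_on_canonical_coef.
have sg (a : aidx A) : smooth_on (aimg (tatlas A) a) (g a) by exact: smooth_on_metric.
have hN := @conn_coef_horizontal _ _ _ _ _ lawL.
have dg (a : aidx A) z : aimg (tatlas A) a z -> derivable (g a) z (S (tinv a z) a).
  by move=> Uz; apply: derivable_smooth Uz; exact: sg.
have gT (a : aidx A) z : aimg (tatlas A) a z -> (g a z)^T = g a z by case/(hg.2 a z).
have DT (a : aidx A) z : aimg (tatlas A) a z ->
    (metric_deriv S g a z)^T = metric_deriv S g a z.
  move=> Uz; rewrite /metric_deriv -(derive_trmx (dg a z Uz)).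
  by apply: near_eq_derive; apply: open_near Uz _; [exact: open_aimg|exact: gT].
exists (horizontal L); split.
- exact: horizontal_connection.
- apply: (metric_connectionP hN sg) => a z Uz.
  by apply: canonical_mx_metric; [exact: metric_unit Uz|exact: gT|exact: DT].
- move=> a z Uz i j; rewrite (hN _ _ Uz).
  rewrite (canonical_mx_obata _ _ _ (gT _ _ Uz) (DT _ _ Uz)).
  congr (_ * _ + _); apply: eq_bigr => k _.
    by rewrite /metric_deriv (derive_mxE _ _ (dg _ _ Uz)).
  by apply: eq_bigr => s _; rewrite [X in _ * X]mxE.
Qed.
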